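(* Let $(X,\mathbf h,\Lambda_0,\widetilde B_0)$ be a coprime quantum seed and $i\in[1,n]$, with $(X',\mathbf h,\Lambda_1,\widetilde B_1)=\mu_i(X,\mathbf h,\Lambda_0,\widetilde B_0)$. Then $$\mathcal U(X,\mathbf h,\Lambda_0,\widetilde B_0)=\mathcal U(X',\mathbf h,\Lambda_1,\widetilde B_1).$$ Moreover, if every quantum seed mutation-equivalent to $(X,\mathbf h,\Lambda_0,\widetilde B_0)$ is coprime, then for every seed $\Sigma$ mutation-equivalent to $(X,\mathbf h,\Lambda_0,\widetilde B_0)$ the upper bound $\mathcal U(\Sigma)$ equals the generalized quantum upper cluster algebra $\widetilde{\mathcal U}(X,\mathbf h,\Lambda_0,\widetilde B_0)$.
   Context: Notation: $[a,b]=\{a,a+1,\dots,b\}$; $[x]_+=\max(x,0)$, applied entrywise to vectors; $e_1,\dots,e_m$ is the standard basis of $\mathbb Z^m$. Fix integers $m\ge n\ge 1$. A compatible pair $(\Lambda,\widetilde B)$ consists of an $m\times n$ integer matrix $\widetilde B=(b_{kl})$ and a skew-symmetric $m\times m$ integer matrix $\Lambda$ such that $\Lambda\widetilde B=-\begin{bmatrix}D\\0\end{bmatrix}$ for some $D=\mathrm{diag}(\tilde d_1,\dots,\tilde d_n)$ with all $\tilde d_k\in\mathbb Z_{>0}$. Write $\Lambda(a,b)=a^T\Lambda b$. Fix positive integers $d_1,\dots,d_n$ such that $d_k$ divides every entry of the $k$-th column $b^k$ of $\widetilde B$ (preserved under mutation); $\beta^k=\frac1{d_k}b^k$. The quantum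 torus $\mathcal T(\Lambda)$ is the $\mathbb Z[q^{\pm1/2}]$-algebra with basis $\{X(c)\mid c\in\mathbb Z^m\}$ and multiplication $X(c)X(d)=q^{\frac12\Lambda(c,d)}X(c+d)$; $\mathcal F$ is its skew field of fractions, $X_k=X(e_k)$. For $k\in[1,n]$, $\mathbf h_k=(h_{k,0},\dots,h_{k,d_k})$ with $h_{k,r}\in\mathbb Z[q^{\pm1/2}]$, $h_{k,r}=h_{k,d_k-r}$, $h_{k,0}=h_{k,d_k}=1$. A quantum seed $(X,\mathbf h,\Lambda,\widetilde B)$ consists of a compatible pair, $\mathbf h$, and a map $X:\mathbb Z^m\to\mathcal F$ with $X(c)X(d)=q^{\frac12\Lambda(c,d)}X(c+d)$. Mutation in direction $i$: $\mu_i(X,\mathbf h,\Lambda,\widetilde B)=(X',\mathbf h,E^T\Lambda E,E\widetilde BF)$ where $E_{kl}=\delta_{kl}$ ($l\neq i$), $E_{ii}=-1$, $E_{ki}=[-\varepsilon b_{ki}]_+$ ($k\ne i$), $F_{kl}=\delta_{kl}$ ($k\ne i$), $F_{ii}=-1$, $F_{il}=[\varepsilon b_{il}]_+$ ($l\ne i$), $\varepsilon\in\{\pm1\}$ arbitrary, and $X'$ is the map satisfying $X'(c)X'(d)=q^{\frac12\Lambda'(c,d)}X'(c+d)$ for $\Lambda'=E^T\Lambda E$, determined by $X'(e_k)=X(e_k)$ ($k\ne i$) and $X'(e_i)=\sum_{r=0}^{d_i}h_{i,r}X(r[\beta^i]_++(d_i-r)[-\beta^i]_+-e_i)$; write $X'_k=X'(e_k)$.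 Seeds related by finite sequences of mutations are mutation-equivalent ($\sim$); $X_{n+1},\dots,X_m$ are unchanged by mutation. $\mathbb{ZP}$ is the ring of Laurent polynomials in $X_{n+1},\dots,X_m$ with coefficients in $\mathbb Z[q^{\pm1/2}]$; for $Y_1,\dots,Y_s\in\mathcal F$, $\mathbb{ZP}[Y_1,\dots,Y_s]$ is the subring of $\mathcal F$ generated by $\mathbb{ZP}$ and the $Y_k$ (exponent $\pm1$ means both $Y$ and $Y^{-1}$ are adjoined). For a seed $\Sigma=(X,\mathbf h,\Lambda,\widetilde B)$ let $\mathbb L(\Sigma)=\mathbb{ZP}[X_1^{\pm1},\dots,X_n^{\pm1}]$; the upper bound is $\mathcal U(\Sigma)=\mathbb L(\Sigma)\cap\bigcap_{i=1}^n\mathbb L(\mu_i(\Sigma))$. The generalized quantum upper cluster algebra is $\widetilde{\mathcal U}(\Sigma)=\bigcap_{\Sigma'\sim\Sigma}\mathbb L(\Sigma')$. For $i\neq j$, $X_iX'_i$ and $X_jX'_j$ (with $X'_k$ the $k$-th cluster variable of $\mu_k(\Sigma)$) are coprime if there is no non-invertible element $c$ of the center of $\mathbb{ZP}[X_1,\dots,X_n]$ dividing both; $\Sigma$ is coprime if this holds for all $i\ne j\in[1,n]$. *)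

(* Defs.v *)
From HB Require Import structures.
From mathcomp Require Import all_boot all_order all_algebra.
Set Implicit Arguments.
Unset Strict Implicit.
Unset Printing Implicit Defensive.
Import Order.TTheory GRing.Theory Num.Theory.
Local Open Scope ring_scope.

(* Ambient setting: F is a division ring (playing the role of the skew field
   of fractions of the initial quantum torus), v : F is a central unit playing
   the role of q^{1/2}.  Vectors of Z^m are integer column vectors. *)

Inductive gen_ring (F : unitRingType) (S : F -> Prop) : F -> Prop :=
  | gen_in x : S x -> gen_ring S x
  | gen_0 : gen_ring S 0
  | gen_1 : gen_ring S 1
  | gen_add x y : gen_ring S x -> gen_ring S y -> gen_ring S (x + y)
  | gen_opp x : gen_ring S x -> gen_ring S (- x)
  | gen_mul x y : gen_ring S x -> gen_ring S y -> gen_ring S (x * y).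

Definition Zq (F : unitRingType) (v : F) : F -> Prop :=
  gen_ring (fun y => y = v \/ y = v^-1).

Definition ev (m : nat) (k : nat) : 'cV[int]_m := \col_(j < m) ((j == k :> nat)%:Z).

Definition posv (m : nat) (c : 'cV[int]_m) : 'cV[int]_m := map_mx (fun x => Num.max x 0) c.

Definition lam (m : nat) (L : 'M[int]_m) (a b : 'cV[int]_m) : int :=
  ((a^T *m L *m b) ord0 ord0).

Record seed (F : unitRingType) (m n : nat) := Seed {
  sX : 'cV[int]_m -> F;
  sL : 'M[int]_m;
  sB : 'M[int]_(m, n) }.

Definition qcomm (F : unitRingType) (v : F) (m : nat) (L : 'M[int]_m)
  (X : 'cV[int]_m -> F) : Prop :=
  forall c d, X c * X d = v ^ (lam L c d) * X (c + d).

(* toric frame condition: the elements q^{j/2} X(c) are Z-linearly independent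
   (i.e. X(Z^m) is Z[q^{±1/2}]-linearly independent, q an indeterminate) *)
Definition toric_indep (F : unitRingType) (v : F) (m : nat) (X : 'cV[int]_m -> F) : Prop :=
  forall (s : seq (int * 'cV[int]_m)) (z : int * 'cV[int]_m -> int),
    uniq s ->
    \sum_(p <- s) (z p)%:~R * v ^ p.1 * X p.2 = 0 ->
    forall p, p \in s -> z p = 0.

Definition is_qseed (F : unitRingType) (v : F) (m n : nat) (d : 'I_n -> nat)
  (S : seed F m n) : Prop :=
  [/\ (sL S)^T = - sL S,
      (exists D : 'I_n -> int, (forall j, 0 < D j) /\
         forall (k : 'I_m) (j : 'I_n),
           (sL S *m sB S) k j = if (k : nat) == (j : nat) then - D j else 0),
      (forall (k : 'I_m) (j : 'I_n), ((d j)%:Z %| sB S k j)%Z),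
      qcomm v (sL S) (sX S) &
      toric_indep v (sX S)].

Section Mutation.
Variables (F : unitRingType) (v : F) (m n : nat) (nm : (n <= m)%N)
          (d : 'I_n -> nat) (h : 'I_n -> nat -> F).

Definition beta (S : seed F m n) (i : 'I_n) : 'cV[int]_m :=
  \col_(k < m) (sB S k i %/ (d i)%:Z)%Z.

Definition mutvar (S : seed F m n) (i : 'I_n) : F :=
  \sum_(r < (d i).+1)
     h i r * sX S ((r%:Z) *: posv (beta S i) + ((d i - r)%N%:Z) *: posv (- beta S i)
                   - ev m i).

Definition sgn (eps : bool) : int := if eps then 1 else -1.

Definition Emat (S : seed F m n) (i : 'I_n) (eps : bool) : 'M[int]_m :=
  \matrix_(k < m, l < m)
    if (l : nat) == (i : nat) then
      (if (k : nat) == (i : nat) then -1 else Num.max (- (sgn eps * sB S k i)) 0)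
    else ((k == l)%:Z).

Definition Fmat (S : seed F m n) (i : 'I_n) (eps : bool) : 'M[int]_n :=
  \matrix_(k < n, l < n)
    if k == i then
      (if l == i then -1 else Num.max (sgn eps * sB S (widen_ord nm i) l) 0)
    else ((k == l)%:Z).

Definition mutation (i : 'I_n) (S S' : seed F m n) : Prop :=
  exists eps : bool,
    [/\ sL S' = (Emat S i eps)^T *m sL S *m Emat S i eps,
        sB S' = Emat S i eps *m sB S *m Fmat S i eps,
        qcomm v (sL S') (sX S'),
        (forall k : 'I_m, (k : nat) != (i : nat) -> sX S' (ev m k) = sX S (ev m k)) &
        sX S' (ev m i) = mutvar S i].

Inductive mut_equiv (S : seed F m n) : seed F m n -> Prop :=
  | me_refl : mut_equiv S S
  | me_step S1 S2 i : mut_equiv S S1 -> mutation i S1 S2 -> mut_equiv S S2.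

Definition Lring (S : seed F m n) : F -> Prop :=
  gen_ring (fun y => y = v \/ y = v^-1 \/
     exists k : 'I_m, y = sX S (ev m k) \/ y = (sX S (ev m k))^-1).

Definition Ubound (S : seed F m n) (x : F) : Prop :=
  Lring S x /\ forall (i : 'I_n) (S' : seed F m n), mutation i S S' -> Lring S' x.

Definition Utilde (S : seed F m n) (x : F) : Prop :=
  forall S', mut_equiv S S' -> Lring S' x.

Definition Rpos (S : seed F m n) : F -> Prop :=
  gen_ring (fun y => y = v \/ y = v^-1 \/
     (exists k : 'I_m, (n <= k)%N /\ (y = sX S (ev m k) \/ y = (sX S (ev m k))^-1)) \/
     (exists k : 'I_m, (k < n)%N /\ y = sX S (ev m k))).

Definition coprime_seed (S : seed F m n) : Prop :=
  forall i j : 'I_n, i != j ->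
    ~ exists c : F,
        [/\ Rpos S c,
            (forall y, Rpos S y -> c * y = y * c),
            ~ (exists c', [/\ Rpos S c', c * c' = 1 & c' * c = 1]),
            (exists r, Rpos S r /\ sX S (ev m i) * mutvar S i = c * r) &
            (exists r, Rpos S r /\ sX S (ev m j) * mutvar S j = c * r)].

End Mutation.

(* Main.v *)
Require Import Defs.
From HB Require Import structures.
From mathcomp Require Import all_boot all_order all_algebra.
From mathcomp Require Import zify ring.
From Stdlib Require Import ClassicalEpsilon.
Import Order.TTheory GRing.Theory Num.Theory.
Local Open Scope ring_scope.
Set Implicit Arguments.
Unset Strict Implicit.
Unset Printing Implicit Defensive.

(** The heart of the matter is a statement of rank two: for [i != j], an element
    of the quantum tori of [S], [mu_i S] and [mu_j S] belongs to the quantum torus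
    of [mu_j mu_i S].  Reindexing the frame of [mu_i S] by the tropical matrix [E]
    gives a frame [Z] with the same form as the frame [X] of [S], equal to [X] on
    vectors with zero [i]-th coordinate, and with
    [Z u1 = \sum_r h_r X (u1 + r b1)].  If the sign in [E] is chosen according to
    [b_ij], the mutations of [X] and of [Z] in direction [j] are given by the same
    vectors [u2] and [b2], so the isomorphism [tau : X c |-> Z c] maps the ring [D],
    the intersection of the tori of [S] and [mu_j S], into the torus of
    [mu_j mu_i S].
    The grading [phi c = +- Lambda (c, e_i)] vanishes on [b2] and is positive on
    [b1]: hence [D] is a graded ring and, after multiplication by a power of the new
    variable, [tau] preserves lowest terms.  So if [tau y] lies in the triple
    intersection, the lowest layer [y_t] of [y] lies in [D] and [tau y_t] in the
    torus of [mu_j mu_i S]; subtract it and use induction on the number of layers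
    of [y]. *)

(** * Scalars: powers of the central unit [v] and the ring they generate *)

Section CentralUnit.
Variables (F : unitRingType) (v : F).
Hypotheses (v_unit : v \is a GRing.unit) (v_central : forall x : F, v * x = x * v).

Lemma expvD a b : v ^ (a + b) = v ^ a * v ^ b.
Proof. exact: exprzDr. Qed.

Lemma expvC a (x : F) : v ^ a * x = x * v ^ a.
Proof.
apply/esym; apply: commrXz; exact/esym.
Qed.

Lemma mulvCA a (x y : F) : x * (v ^ a * y) = v ^ a * (x * y).
Proof. by rewrite mulrA -expvC mulrA. Qed.

Lemma mulvA a b (x : F) : v ^ a * (v ^ b * x) = v ^ (a + b) * x.
Proof. by rewrite expvD mulrA. Qed.

Lemma Zq_comm (z x : F) : Zq v z -> z * x = x * z.
Proof.
move=> zq; elim: zq x => {z} [y [] ->|||y z _ IHy _ IHz|y _ IHy|y z _ IHy _ IHz] x.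
- exact: v_central.
- by have := expvC (-1) x; rewrite exprN1.
- by rewrite mul0r mulr0.
- by rewrite mul1r mulr1.
- by rewrite mulrDl mulrDr IHy IHz.
- by rewrite mulNr mulrN IHy.
- by rewrite -mulrA IHz mulrA IHy mulrA.
Qed.

Lemma Zq_int (z : int) : Zq v z%:~R.
Proof.
suff Zq_nat k : Zq v k%:R.
  by case: z => k; [|rewrite NegzE rmorphN; apply: gen_opp]; apply: Zq_nat.
by elim: k => [|k IHk]; [apply: gen_0|rewrite -natr1; apply: gen_add => //; apply: gen_1].
Qed.

End CentralUnit.

(** * Frames of a quantum torus *)

Section Frames.
Variables (F : unitRingType) (v : F).
Hypothesis Fdiv : forall x : F, x != 0 -> x \is a GRing.unit.
Hypotheses (v_unit : v \is a GRing.unit) (v_central : forall x : F, v * x = x * v).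
Variables (V : zmodType) (lam : V -> {additive V -> int}).
Hypothesis lam_skew : forall a b, lam b a = - lam a b.

Local Notation mulvCA := (mulvCA v_central).
Local Notation mulvA := (mulvA v_unit).

Section IntegerFunctionals.
Variable f : {additive V -> int}.

Lemma form0 : f 0 = 0.
Proof. exact: raddf0. Qed.

Lemma formD a b : f (a + b) = f a + f b.
Proof. exact: raddfD. Qed.

Lemma formN a : f (- a) = - f a.
Proof. exact: raddfN. Qed.

Lemma formB a b : f (a - b) = f a - f b.
Proof. exact: raddfB. Qed.

Lemma formMn a k : f (a *+ k) = f a * k%:Z.
Proof. by rewrite raddfMn -mulr_natr natz. Qed.

End IntegerFunctionals.

Lemma lamDl a b c : lam (a + b) c = lam a c + lam b c.
Proof. by rewrite ![lam _ c]lam_skew formD opprD. Qed.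

Lemma lamNl a c : lam (- a) c = - lam a c.
Proof. by rewrite ![lam _ c]lam_skew formN. Qed.

Lemma lamMnl a c k : lam (a *+ k) c = lam a c * k%:Z.
Proof. by rewrite ![lam _ c]lam_skew formMn mulNr. Qed.

Lemma lam_id a : lam a a = 0.
Proof. have := lam_skew a a; lia. Qed.

(** The normalisation at [0] excludes the zero map, which also satisfies the product rule. *)
Definition is_frame (X : V -> F) : Prop :=
  X 0 = 1 /\ forall c d, X c * X d = v ^ lam c d * X (c + d).

Definition independent (X : V -> F) : Prop :=
  forall (s : seq (int * V)) (z : int * V -> int), uniq s ->
  \sum_(p <- s) (z p)%:~R * v ^ p.1 * X p.2 = 0 -> forall p, p \in s -> z p = 0.

(** * Monomials of a frame and the modules they span *)

Section OneFrame.
Variable X : V -> F.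
Hypothesis frX : is_frame X.

Lemma frameM c d : X c * X d = v ^ lam c d * X (c + d).
Proof. by case: frX. Qed.

Lemma frameD c d : X (c + d) = v ^ (- lam c d) * (X c * X d).
Proof. by rewrite frameM mulvA addNr mul1r. Qed.

Lemma frameN c : X (- c) * X c = 1.
Proof. by rewrite frameM addNr lamNl lam_id oppr0 expr0z mul1r; case: frX. Qed.

Lemma frameVN c : X c * X (- c) = 1.
Proof. by rewrite -{1}[c]opprK frameN. Qed.

Lemma frame_unit c : X c \is a GRing.unit.
Proof. by apply/unitrP; exists (X (- c)); rewrite frameN frameVN. Qed.

Lemma frameV c : (X c)^-1 = X (- c).
Proof. by apply: (mulrI (frame_unit c)); rewrite frameVN divrr ?frame_unit. Qed.

Lemma frameX c k : X c ^+ k = X (c *+ k).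
Proof.
elim: k => [|k IHk]; first by rewrite expr0 mulr0n; case: frX.
by rewrite exprS IHk frameM formMn lam_id mul0r expr0z mul1r -mulrS.
Qed.

(** A module over [Z[v, v^-1]]: powers of [v] sit in the generators, so that inductions on
    membership need no case for scalars. *)
Inductive span (P : V -> Prop) : F -> Prop :=
  | span_0 : span P 0
  | span_vX a c : P c -> span P (v ^ a * X c)
  | span_D x y : span P x -> span P y -> span P (x + y)
  | span_N x : span P x -> span P (- x).

Definition torus : F -> Prop := span (fun _ => True).

Lemma span_B P x y : span P x -> span P y -> span P (x - y).
Proof. by move=> ? ?; apply: span_D => //; apply: span_N. Qed.

Lemma span_X (P : V -> Prop) c : P c -> span P (X c).
Proof. by move=> Pc; rewrite -[X c]mul1r -[1](expr0z v); apply: span_vX. Qed.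

Lemma span_mono (P Q : V -> Prop) x :
  (forall c, P c -> Q c) -> span P x -> span Q x.
Proof.
move=> PQ; elim=> [|a c /PQ|y z _ ? _ ?|y _ ?].
- exact: span_0.
- exact: span_vX.
- exact: span_D.
- exact: span_N.
Qed.

Lemma span_torus P x : span P x -> torus x.
Proof. exact: span_mono. Qed.

Lemma span_empty (P : V -> Prop) x : (forall c, ~ P c) -> span P x -> x = 0.
Proof.
move=> P0; elim=> [//|a c /P0 //|y z _ -> _ ->|y _ ->]; [exact: addr0|exact: oppr0].
Qed.

Lemma span_sum (P : V -> Prop) k (f : nat -> F) :
  (forall r, (r < k)%N -> span P (f r)) -> span P (\sum_(r < k) f r).
Proof.
move=> fP; apply: (big_ind (span P)) => [||i _]; [exact: span_0|exact: span_D|].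
exact: fP.
Qed.

Lemma span_M (P Q R : V -> Prop) x y :
  (forall c d, P c -> Q d -> R (c + d)) -> span P x -> span Q y -> span R (x * y).
Proof.
move=> PQR Px Qy; elim: Px => [|a c Pc|x1 x2 _ IH1 _ IH2|x1 _ IH1].
- by rewrite mul0r; apply: span_0.
- elim: Qy => [|b e Qe|y1 y2 _ IH1 _ IH2|y1 _ IH1].
  + by rewrite mulr0; apply: span_0.
  + rewrite mulvCA -mulrA frameM !mulvA; apply: span_vX; exact: PQR.
  + by rewrite mulrDr; apply: span_D.
  + by rewrite mulrN; apply: span_N.
- by rewrite mulrDl; apply: span_D.
- by rewrite mulNr; apply: span_N.
Qed.

Lemma torus_M x y : torus x -> torus y -> torus (x * y).
Proof. exact: span_M. Qed.

Lemma span_v P a x : span P x -> span P (v ^ a * x).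
Proof.
elim=> [|b c Pc|y z _ ? _ ?|y _ ?].
- by rewrite mulr0; apply: span_0.
- by rewrite mulvA; apply: span_vX.
- by rewrite mulrDr; apply: span_D.
- by rewrite mulrN; apply: span_N.
Qed.

Lemma span_Zq P z x : Zq v z -> span P x -> span P (z * x).
Proof.
move=> zq; elim: zq x => {z} [y [] ->|||y z _ IHy _ IHz|y _ IHy|y z _ IHy _ IHz] x Px.
- by have := span_v 1 Px; rewrite expr1z.
- by have := span_v (-1) Px; rewrite exprN1.
- by rewrite mul0r; apply: span_0.
- by rewrite mul1r.
- by rewrite mulrDl; apply: span_D; auto.
- by rewrite mulNr; apply: span_N; auto.
- by rewrite -mulrA; auto.
Qed.

Lemma torus_exp x k : torus x -> torus (x ^+ k).
Proof.
move=> Tx; elim: k => [|k IHk]; last by rewrite exprS; apply: torus_M.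
by rewrite expr0 -[1](proj1 frX); apply: span_X.
Qed.

End OneFrame.

(** * Linear maps and graded projections on the torus of an independent frame *)

Section IndependentFrame.
Variable X : V -> F.
Hypothesis frX : is_frame X.
Hypothesis indX : independent X.

(* [graph w] is the graph of the linear map [X c |-> w c] on the quantum torus;
   it is functional because the [v ^ a * X c] are independent. *)
Inductive graph (w : V -> F) : F -> F -> Prop :=
  | graph_0 : graph w 0 0
  | graph_X a c : graph w (v ^ a * X c) (v ^ a * w c)
  | graph_D x x' y y' : graph w x y -> graph w x' y' -> graph w (x + x') (y + y')
  | graph_N x y : graph w x y -> graph w (- x) (- y).

Lemma graph_sum w x y : graph w x y -> exists s : seq (int * (int * V)),
  x = \sum_(p <- s) p.1%:~R * v ^ p.2.1 * X p.2.2 /\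
  y = \sum_(p <- s) p.1%:~R * v ^ p.2.1 * w p.2.2.
Proof.
elim=> [|a c|x1 x2 y1 y2 _ [s [-> ->]] _ [t [-> ->]]|x1 y1 _ [s [-> ->]]].
- by exists [::]; rewrite !big_nil; split.
- by exists [:: (1, (a, c))]; rewrite !big_seq1 !mul1r; split.
- by exists (s ++ t); rewrite !big_cat; split.
- exists [seq (- p.1, p.2) | p <- s].
  rewrite !big_map -!sumrN.
  by split; apply: eq_bigr => p _; rewrite rmorphN !mulNr.
Qed.

(** Independence speaks of sums over distinct indices, so terms with the same index are collected
    first. *)
Lemma sum_group (s : seq (int * (int * V))) (w : V -> F) :
  \sum_(p <- s) p.1%:~R * v ^ p.2.1 * w p.2.2 =
  \sum_(k <- undup [seq p.2 | p <- s])
     (\sum_(p <- s | p.2 == k) p.1)%:~R * v ^ k.1 * w k.2.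
Proof.
have split_k k : (\sum_(p <- s | p.2 == k) p.1)%:~R * v ^ k.1 * w k.2 =
    \sum_(p <- s | p.2 == k) p.1%:~R * v ^ p.2.1 * w p.2.2.
  by rewrite rmorph_sum /= !mulr_suml; apply: eq_bigr => p /eqP <-.
under [RHS]eq_bigr => k _ do rewrite split_k.
rewrite (exchange_big_dep predT) //= big_seq [RHS]big_seq; apply: eq_bigr => p ps.
rewrite big_mkcond (bigD1_seq p.2) ?undup_uniq ?mem_undup ?map_f //= eqxx.
by rewrite big1 ?addr0 // => k /negPf kp; rewrite eq_sym kp.
Qed.

Lemma graph_fun0 w x y : graph w x y -> x = 0 -> y = 0.
Proof.
move=> /graph_sum [s [-> ->]]; rewrite !sum_group => sum0.
have z0 := indX (undup_uniq _) sum0.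
rewrite big_seq big1 // => k /z0; rewrite /= => ->.
by rewrite !mul0r.
Qed.

Lemma graph_fun w x y y' : graph w x y -> graph w x y' -> y = y'.
Proof.
move=> g g'; apply/eqP; rewrite -subr_eq0; apply/eqP.
by apply: (graph_fun0 (graph_D g (graph_N g'))); rewrite subrr.
Qed.

Lemma graph_total w x : torus X x -> exists y, graph w x y.
Proof.
elim=> [|a c _|x1 x2 _ [y1 ?] _ [y2 ?]|x1 _ [y1 ?]].
- by exists 0; apply: graph_0.
- by exists (v ^ a * w c); apply: graph_X.
- by exists (y1 + y2); apply: graph_D.
- by exists (- y1); apply: graph_N.
Qed.

(** The linear extension of [X c |-> w c], chosen from its graph; outside the torus of [X] the value
    carries no meaning. *)
Definition ext (w : V -> F) (x : F) : F := epsilon (inhabits 0) (graph w x).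

Lemma ext_graph w x : torus X x -> graph w x (ext w x).
Proof. by move=> /(graph_total w) [y gy]; apply: epsilon_spec; exists y. Qed.

Lemma graph_ext w x y : graph w x y -> ext w x = y.
Proof.
by move=> gy; apply: (@graph_fun w x) => //; apply: epsilon_spec; exists y.
Qed.

Lemma ext0 w : ext w 0 = 0.
Proof. exact/graph_ext/graph_0. Qed.

Lemma extvX w a c : ext w (v ^ a * X c) = v ^ a * w c.
Proof. exact/graph_ext/graph_X. Qed.

Lemma extX w c : ext w (X c) = w c.
Proof. by have := extvX w 0 c; rewrite expr0z !mul1r. Qed.

Lemma extD w x y : torus X x -> torus X y -> ext w (x + y) = ext w x + ext w y.
Proof. by move=> Tx Ty; apply/graph_ext/graph_D; apply: ext_graph. Qed.

Lemma extN w x : torus X x -> ext w (- x) = - ext w x.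
Proof. by move=> Tx; apply/graph_ext/graph_N/ext_graph. Qed.

Lemma extB w x y : torus X x -> torus X y -> ext w (x - y) = ext w x - ext w y.
Proof. by move=> Tx Ty; rewrite extD ?extN //; apply: span_N. Qed.

Lemma ext_sum w k (f : nat -> F) : (forall r, (r < k)%N -> torus X (f r)) ->
  ext w (\sum_(r < k) f r) = \sum_(r < k) ext w (f r).
Proof.
elim: k => [|k IHk] Tf; first by rewrite !big_ord0 ext0.
have Tf' r : (r < k)%N -> torus X (f r) by move=> ?; apply/Tf/ltnW.
by rewrite !big_ord_recr /= extD ?IHk //; [apply: span_sum|apply: Tf].
Qed.

Lemma extv w a x : torus X x -> ext w (v ^ a * x) = v ^ a * ext w x.
Proof.
elim=> [|b c _|y z Ty IHy Tz IHz|y Ty IHy].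
- by rewrite mulr0 ext0 mulr0.
- by rewrite mulvA !extvX mulvA.
- by rewrite mulrDr !extD ?IHy ?IHz ?mulrDr //; apply: span_v.
- by rewrite mulrN !extN ?IHy ?mulrN //; apply: span_v.
Qed.

Lemma ext_Zq w z x : Zq v z -> torus X x -> ext w (z * x) = z * ext w x.
Proof.
move=> zq; elim: zq x => {z} [y [] ->|||y z Zy IHy Zz IHz|y Zy IHy|y z Zy IHy Zz IHz] x Tx.
- by have := extv w 1 Tx; rewrite expr1z.
- by have := extv w (-1) Tx; rewrite exprN1.
- by rewrite !mul0r ext0.
- by rewrite !mul1r.
- by rewrite !mulrDl extD ?IHy ?IHz //; apply: span_Zq.
- by rewrite !mulNr extN ?IHy //; apply: span_Zq.
- by rewrite -!mulrA IHy ?IHz //; apply: span_Zq.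
Qed.

Lemma ext_span (Z : V -> F) (P : V -> Prop) (Q : F -> Prop) x :
  Q 0 -> (forall y z, Q y -> Q z -> Q (y + z)) -> (forall y, Q y -> Q (- y)) ->
  (forall a c, P c -> Q (v ^ a * Z c)) -> span X P x -> Q (ext Z x).
Proof.
move=> Q0 QD QN QX; elim=> [|a c Pc|y z Py ? Pz ?|y Py ?].
- by rewrite ext0.
- by rewrite extvX; apply: QX.
- by rewrite extD; [apply: QD|apply: span_torus Py|apply: span_torus Pz].
- by rewrite extN; [apply: QN|apply: span_torus Py].
Qed.

Lemma extM (Z : V -> F) x y : is_frame Z -> torus X x -> torus X y ->
  ext Z (x * y) = ext Z x * ext Z y.
Proof.
move=> frZ; elim=> [|a c _|x1 x2 T1 IH1 T2 IH2|x1 T1 IH1] Ty.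
- by rewrite !mul0r ext0 mul0r.
- elim: Ty => [|b d _|y1 y2 T1 IH1 T2 IH2|y1 T1 IH1].
  + by rewrite mulr0 !ext0 mulr0.
  + rewrite !extvX mulvCA -[_ * _ * X d]mulrA (frameM frX) !mulvA extvX.
    by rewrite mulvCA -[_ * _ * Z d]mulrA (frameM frZ) !mulvA.
  + by rewrite mulrDr !extD ?IH1 ?IH2 ?mulrDr //; apply: torus_M => //; apply: span_vX.
  + by rewrite mulrN !extN ?IH1 ?mulrN //; apply: torus_M => //; apply: span_vX.
- by rewrite mulrDl !extD ?mulrDl ?IH1 ?IH2 //; apply: torus_M.
- by rewrite mulNr !extN ?mulNr ?IH1 //; apply: torus_M.
Qed.

Lemma ext_exp (Z : V -> F) x k : is_frame Z -> torus X x ->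
  ext Z (x ^+ k) = ext Z x ^+ k.
Proof.
move=> frZ Tx; elim: k => [|k IHk].
  by rewrite !expr0 -(proj1 frX) extX; case: frZ => ->; case: frX.
by rewrite !exprS extM ?IHk //; apply: torus_exp.
Qed.

(** The projection onto the monomials with exponent in [Q]; for [Q] of the form [phi c == t] it
    extracts a homogeneous layer. *)
Definition pr (Q : pred V) : F -> F := ext (fun c => if Q c then X c else 0).

Lemma pr_span (P : V -> Prop) (Q : pred V) x :
  span X P x -> span X (fun c => P c /\ Q c) (pr Q x).
Proof.
apply: ext_span => [|y z|y|a c Pc]; [exact: span_0|exact: span_D|exact: span_N|].
by case: ifP => Qc; [apply: span_vX|rewrite mulr0; apply: span_0].
Qed.

Lemma pr_torus Q x : torus X x -> torus X (pr Q x).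
Proof. by move=> /(pr_span Q)/span_torus. Qed.

Lemma pr_id (Q : pred V) x : span X Q x -> pr Q x = x.
Proof.
rewrite /pr; elim=> [|a c Qc|y z Qy IHy Qz IHz|y Qy IHy].
- by rewrite ext0.
- by rewrite extvX Qc.
- by rewrite extD ?IHy ?IHz //; [apply: span_torus Qy|apply: span_torus Qz].
- by rewrite extN ?IHy //; apply: span_torus Qy.
Qed.

Lemma pr_0 (Q : pred V) x : span X (fun c => ~~ Q c) x -> pr Q x = 0.
Proof.
rewrite /pr; elim=> [|a c /negPf Qc|y z Qy IHy Qz IHz|y Qy IHy].
- by rewrite ext0.
- by rewrite extvX Qc mulr0.
- by rewrite extD ?IHy ?IHz ?addr0 //; [apply: span_torus Qy|apply: span_torus Qz].
- by rewrite extN ?IHy ?oppr0 //; apply: span_torus Qy.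
Qed.

Lemma pr_compl (P : V -> Prop) (Q : pred V) x :
  span X P x -> span X (fun c => P c /\ ~~ Q c) (x - pr Q x).
Proof.
rewrite /pr; elim=> [|a c Pc|y z Py IHy Pz IHz|y Py IHy].
- by rewrite ext0 subrr; apply: span_0.
- rewrite extvX; case: ifPn => Qc; first by rewrite subrr; apply: span_0.
  by rewrite mulr0 subr0; apply: span_vX.
- rewrite extD; [|exact: span_torus Py|exact: span_torus Pz].
  by rewrite opprD addrACA; apply: span_D.
- by rewrite extN; [rewrite -opprD; apply: span_N|apply: span_torus Py].
Qed.

(** Multiplication by [x] translates exponents by elements of [P], so it carries the part selected
    by [Q] to the part selected by [Q']. For homogeneous [x] this is a shift of degree. *)
Lemma prM (P : V -> Prop) (Q Q' : pred V) x y :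
  (forall c d, P c -> Q' (c + d) = Q d) ->
  span X P x -> torus X y -> pr Q' (x * y) = x * pr Q y.
Proof.
move=> PQ Px Ty; elim: Px => [|a c Pc|x1 x2 P1 IH1 P2 IH2|x1 P1 IH1].
- by rewrite !mul0r /pr ext0.
- rewrite /pr; elim: Ty => [|b d _|y1 y2 T1 IH1 T2 IH2|y1 T1 IH1].
  + by rewrite mulr0 !ext0 mulr0.
  + rewrite !extvX mulvCA -[_ * _ * X d]mulrA (frameM frX) !mulvA extvX PQ //.
    case: (Q d); last by rewrite !mulr0.
    by rewrite mulvCA -[_ * _ * X d]mulrA (frameM frX) !mulvA.
  + by rewrite mulrDr !extD ?IH1 ?IH2 ?mulrDr //; apply: torus_M => //; apply: span_vX.
  + by rewrite mulrN !extN ?IH1 ?mulrN //; apply: torus_M => //; apply: span_vX.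
- have T1 := span_torus P1; have T2 := span_torus P2.
  by rewrite mulrDl /pr !extD -/(pr _ _) ?mulrDl -?IH1 -?IH2 //; apply: torus_M.
- have T1 := span_torus P1.
  by rewrite mulNr /pr !extN -/(pr _ _) ?mulNr -?IH1 //; apply: torus_M.
Qed.

(** Only finitely many monomials occur. The width [K] of the window is the measure in later
    inductions on layers. *)
Lemma span_bounded (phi : V -> int) (P : V -> Prop) x : span X P x ->
  exists t, exists K : nat, span X (fun c => P c /\ t <= phi c < t + K%:Z) x.
Proof.
elim=> [|a c Pc|x1 x2 _ [t1 [K1 s1]] _ [t2 [K2 s2]]|x1 _ [t1 [K1 s1]]].
- by exists 0, 0%N; apply: span_0.
- by exists (phi c), 1%N; apply: span_vX; split; [|lia].
- exists (Num.min t1 t2), (absz t1 + absz t2 + absz t1 + absz t2 + K1 + K2)%N.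
  by apply: span_D; [apply: span_mono s1|apply: span_mono s2] => c [Pc ?]; (split; [|lia]).
- by exists t1, K1; apply: span_N.
Qed.

End IndependentFrame.

(* Mutation of frames, the new frame [Z] being reindexed by the tropical
   transformation so that [X] and [Z] have the same form [lam]; [u] is the tropical
   image of the mutated basis vector, [b] is the signed vector [beta], and [kap] is
   the coordinate in the direction of the mutation. *)
Record frame_mut (kap : {additive V -> int}) (u b : V) (d : nat) (h : nat -> F)
    (X Z : V -> F) : Prop := FrameMut {
  fm_frame : is_frame Z;
  fm_u : kap u = -1;
  fm_b : kap b = 0;
  fm_lam : forall c, kap c = 0 -> lam c b = 0;
  fm_eq : forall c, kap c = 0 -> Z c = X c;
  fm_var : Z u = \sum_(r < d.+1) h r * X (u + b *+ r) }.

(** The term [r = 0] is [X u] itself, and each further [b] raises the degree. *)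
Lemma binomial_lowest (X : V -> F) (h : nat -> F) d u b (chi : {additive V -> int}) :
  (forall r, Zq v (h r)) -> h 0%N = 1 -> 0 < chi b ->
  span X (fun c => chi u < chi c) (\sum_(r < d.+1) h r * X (u + b *+ r) - X u).
Proof.
move=> h_coef h_0 chib; rewrite big_ord_recl /= h_0 mul1r mulr0n addr0 addrC addKr.
apply: (span_sum (f := fun r => h r.+1 * X (u + b *+ r.+1))) => r _.
apply: span_Zq => //; apply: span_X; rewrite formD formMn; nia.
Qed.

(** The monomial [X u] of lowest degree cannot be cancelled by the other terms, and it is a unit. *)
Lemma binomial_neq0 (X : V -> F) (h : nat -> F) d u b (chi : {additive V -> int}) :
  is_frame X -> independent X ->
  (forall r, Zq v (h r)) -> h 0%N = 1 -> 0 < chi b ->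
  \sum_(r < d.+1) h r * X (u + b *+ r) != 0.
Proof.
move=> frX indX h_coef h_0 chib; apply/eqP => sum0.
have := binomial_lowest X d u h_coef h_0 chib; rewrite sum0 sub0r => Su.
have Xu : span X (fun c => chi c == chi u) (X u) by apply: span_X.
have := frame_unit frX u; rewrite -(pr_id indX Xu) -[X u]opprK.
rewrite (pr_0 indX) ?unitr0 //; apply: span_N.
by apply: span_mono Su => c; lia.
Qed.

(** * Comparison of the tori of a frame and its mutation *)

Section FrameMutation.
Variables (kap : {additive V -> int}) (u b : V) (d : nat) (h : nat -> F).
Hypothesis h_coef : forall r, Zq v (h r).
Variables (X Z : V -> F).
Hypothesis frX : is_frame X.
Hypothesis fm : frame_mut kap u b d h X Z.

Let frZ := fm_frame fm.

Let hCA r x y : x * (h r * y) = h r * (x * y).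
Proof. by rewrite !mulrA (Zq_comm v_central x (h_coef r)). Qed.

Lemma fm_unit : Z u \is a GRing.unit.
Proof. exact: frame_unit. Qed.

Lemma fm_var_kap : span X (fun c => kap c = -1) (Z u).
Proof.
rewrite (fm_var fm); apply: (span_sum (f := fun r => h r * X (u + b *+ r))) => r _.
apply: span_Zq => //; apply: span_X; rewrite formD formMn (fm_b fm) (fm_u fm).
by rewrite mul0r addr0.
Qed.

Lemma fm_var_torus : torus X (Z u).
Proof. exact: span_torus fm_var_kap. Qed.

(** Multiply the exchange relation on the left by [Z g = X g]: since [lam g b = 0], every term
    acquires the same power of [v]. Thus [u] matters only up to vectors with [kap] zero. *)
Lemma fm_shift g : kap g = 0 -> frame_mut kap (u + g) b d h X Z.
Proof.
move=> kg; case: fm => _ ku kb lb eqZX var; split=> //.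
  by rewrite formD ku kg.
rewrite addrC (frameD frZ) eqZX // var mulr_sumr mulr_sumr; apply: eq_bigr => r _.
rewrite !hCA (frameM frX) mulvA formD formMn lb // mul0r addr0 addNr mul1r.
by rewrite addrA.
Qed.

(** In [X (- u) * Z u] only exponents [b *+ r] remain, where the two frames agree; hence [X (- u)]
    lies in the new torus. For [kap c > 0], split off one factor [X (- u)] at a time. *)
Lemma fm_old_in_new c : 0 <= kap c -> torus Z (X c).
Proof.
have stepN : torus Z (X (- u)).
  rewrite -[X (- u)](mulrK fm_unit) (frameV frZ).
  apply: torus_M => //; last exact: span_X.
  rewrite (fm_var fm) mulr_sumr.
  apply: (span_sum (f := fun r => X (- u) * (h r * X (u + b *+ r)))) => r _.
  rewrite hCA (frameM frX) addKr.
  apply: span_Zq => //; apply: span_v; rewrite -(fm_eq fm) ?formMn ?(fm_b fm) ?mul0r //.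
  exact: span_X.
move kc : (kap c) => k; case: k kc => // k kc _; elim: k c kc => [|k IHk] c kc.
  by rewrite -(fm_eq fm) //; apply: span_X.
have -> : c = - u + (c + u) by rewrite addrC addrK.
rewrite (frameD frX); apply: span_v; apply: torus_M => //; apply: IHk.
rewrite formD kc (fm_u fm); lia.
Qed.

(** After multiplication by [Z u] both sides expand in exponents [g + b *+ r] with [kap] zero, where
    [X] and [Z] agree. This is why mutation is an involution. *)
Lemma fm_involutive g : kap g = 0 ->
  X (g - u) = \sum_(r < d.+1) h r * Z (g - u + b *+ r).
Proof.
move=> kg; apply: (mulrI fm_unit).
rewrite [in LHS](fm_var fm) mulr_suml mulr_sumr; apply: eq_bigr => r _.
rewrite hCA -!mulrA; congr (_ * _).
rewrite (frameM frX) (frameM frZ).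
have -> : u + (g - u + b *+ r) = g + b *+ r by rewrite addrA addrCA subrr addr0.
have -> : u + b *+ r + (g - u) = g + b *+ r.
  by rewrite addrC -addrA addKr.
rewrite (fm_eq fm) ?formD ?formMn ?(fm_b fm) ?kg ?mul0r //; congr (v ^ _ * _).
have := fm_lam fm kg; have := lam_skew g b; have := lam_skew u b.
rewrite !(formD, formN, formMn, lamDl, lamMnl) lam_id => -> -> ->; ring.
Qed.

Hypothesis h_0 : h 0%N = 1.

Lemma fm_var_lowest (chi : {additive V -> int}) : 0 < chi b ->
  span X (fun c => chi u < chi c) (Z u - X u).
Proof. by rewrite (fm_var fm); apply: binomial_lowest. Qed.

(* In the twisted indexing, passing to the mutated frame does not change the
   lowest term of a monomial, for any grading in which [b] is positive. *)
Lemma fm_lowest (chi : {additive V -> int}) c : 0 < chi b -> kap c <= 0 ->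
  span X (fun e => chi c < chi e) (Z c - X c).
Proof.
move=> chib kc0; move kc : (absz (kap c)) => k.
have {kc0 kc} : kap c = - k%:Z by lia.
elim: k c => [|k IHk] c kc; first by rewrite (fm_eq fm) // subrr; apply: span_0.
have -> : c = u + (c - u) by rewrite addrC subrK.
have kcu : kap (c - u) = - k%:Z by rewrite formB kc (fm_u fm); lia.
rewrite (frameD frX) (frameD frZ) -mulrBr; apply: span_v.
have -> : Z u * Z (c - u) - X u * X (c - u) =
    (Z u - X u) * X (c - u) + Z u * (Z (c - u) - X (c - u)).
  by rewrite mulrBl mulrBr [RHS]addrC addrA subrK.
apply: span_D.
  apply: span_M (fm_var_lowest chib) (@span_X X (fun e => e = c - u) _ erefl) => //.
  move=> e f; rewrite !formD => ? ->; rewrite !formD; lia.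
rewrite -[Z u](subrK (X u)) mulrDl; apply: span_D.
  by apply: span_M (fm_var_lowest chib) (IHk _ kcu) => // e f; rewrite !formD /=; lia.
apply: span_M (@span_X X (fun e => e = u) _ erefl) (IHk _ kcu) => // e f ->.
by rewrite !formD /=; lia.
Qed.

Hypothesis indX : independent X.

(** By [fm_lowest] the map [X c |-> Z c] is the identity modulo higher layers on monomials with
    [kap c <= 0]. *)
Lemma ext_lowest (phi : {additive V -> int}) t x : 0 < phi b ->
  span X (fun c => kap c <= 0 /\ t <= phi c) x ->
  torus X (ext X Z x) /\
  pr X (fun c => phi c == t) (ext X Z x) = pr X (fun c => phi c == t) x.
Proof.
move=> phib Sx.
have Sd : span X (fun c => t < phi c) (ext X Z x - x).
  elim: Sx => [|a c [kc tc]|y z Sy IHy Sz IHz|y Sy IHy].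
  - by rewrite (ext0 indX) subrr; apply: span_0.
  - rewrite (extvX indX) -mulrBr; apply: span_v.
    apply: span_mono (fm_lowest phib kc) => e; lia.
  - have Ty := span_torus Sy; have Tz := span_torus Sz.
    by rewrite (extD indX) // opprD addrACA; apply: span_D.
  - by rewrite (extN indX _ (span_torus Sy)) -opprD; apply: span_N.
have Tx := span_torus Sx; have Td := span_torus Sd.
rewrite -[ext X Z x](subrK x); split; first exact: span_D.
rewrite /pr (extD indX) // -!/(pr _ _ _) [X in X + _](pr_0 indX) ?add0r //.
by apply: span_mono Sd => c; lia.
Qed.

(** Since [kap u = -1], a large multiple of [u] moves all exponents into the range [kap <= 0] of
    [ext_lowest]. *)
Lemma frame_shift_down x : torus X x ->
  exists N0 : nat, forall N : nat, (N0 <= N)%N ->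
    span X (fun c => kap c <= 0) (X (u *+ N) * x).
Proof.
move=> Tx; have [t [K St]] := span_bounded kap Tx.
exists (absz t + K)%N => N leN.
apply: (span_M frX _ (@span_X X (fun e => e = u *+ N) _ erefl) St) => e c -> [_ kc].
rewrite formD formMn (fm_u fm); lia.
Qed.

(** After a shift into [kap <= 0], the lowest [phi]-layer of an element of the kernel is that of its
    image [0]; removing layers one at a time leaves nothing. *)
Lemma ext_inj (phi : {additive V -> int}) x : 0 < phi b ->
  torus X x -> ext X Z x = 0 -> x = 0.
Proof.
move=> phib Tx Ex; have [N /(_ N (leqnn N)) SN] := frame_shift_down Tx.
apply: (mulrI (frame_unit frX (u *+ N))); rewrite mulr0.
have {Ex} : ext X Z (X (u *+ N) * x) = 0.
  by rewrite (extM frX indX frZ) ?Ex ?mulr0 //; apply: span_X.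
have [t [K St]] := span_bounded phi SN.
elim: K t {SN Tx} (X (u *+ N) * x) St => [|K IHK] t y Sy Ey.
  by apply: span_empty Sy => c [_]; lia.
have Sy' : span X (fun c => kap c <= 0 /\ t <= phi c) y.
  by apply: span_mono Sy => c []; lia.
have [_] := ext_lowest phib Sy'; rewrite Ey /pr (ext0 indX) -/(pr _ _) => y0.
apply: (IHK (t + 1)) => //; rewrite -[y]subr0 y0.
apply: span_mono (pr_compl indX (fun c => phi c == t) Sy) => c; lia.
Qed.

(** A relation among the [Z c] is the image of the same relation among the [X c] under an injective
    map. *)
Lemma fm_independent (phi : {additive V -> int}) : 0 < phi b -> independent Z.
Proof.
move=> phib s z us sZ.
have Tz q : torus X ((z q)%:~R * v ^ q.1 * X q.2).
  by rewrite -mulrA; apply: span_Zq => //; [apply: Zq_int|apply: span_vX].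
have Ts t : torus X (\sum_(p <- t) (z p)%:~R * v ^ p.1 * X p.2).
  by apply: (big_ind (torus X)) => [||q _]; [exact: span_0|exact: span_D|].
apply: (indX us); apply: (ext_inj phib) => //; rewrite -[RHS]sZ.
elim: s {us sZ} => [|p s IHs]; first by rewrite !big_nil (ext0 indX).
rewrite !big_cons (extD indX) ?IHs // -!mulrA (ext_Zq indX _ (Zq_int v _)) ?(extvX indX) //.
exact: span_vX.
Qed.

End FrameMutation.

(** * Construction of a mutated frame *)

Section Existence.
Variables (kap phi : {additive V -> int}) (u b : V) (d : nat) (h : nat -> F).
Hypotheses (h_coef : forall r, Zq v (h r)) (h_0 : h 0%N = 1).
Variable X : V -> F.
Hypotheses (frX : is_frame X) (indX : independent X).
Hypotheses (ku : kap u = -1) (kb : kap b = 0).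
Hypothesis lb : forall c, kap c = 0 -> lam c b = 0.
Hypothesis phib : 0 < phi b.

Let y := \sum_(r < d.+1) h r * X (u + b *+ r).

Let y_unit : y \is a GRing.unit.
Proof. by apply: Fdiv; apply: binomial_neq0 phib. Qed.

(** The exponents of [y] differ by multiples of [b], which pairs to zero with [c], so one power of
    [v] serves for every term. *)
Let y_comm1 c : kap c = 0 -> X c * y = v ^ (- (lam u c * 2)) * (y * X c).
Proof.
move=> kc; rewrite /y mulr_suml !mulr_sumr; apply: eq_bigr => r _.
rewrite mulrA -(Zq_comm v_central _ (h_coef r)) -!mulrA -mulvCA; congr (_ * _).
rewrite !(frameM frX) mulvA [c + _]addrC; congr (v ^ _ * _).
rewrite lamDl lamMnl formD formMn lb // [lam c u]lam_skew [lam b c]lam_skew lb //.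
by ring.
Qed.

Let y_comm (k : int) c : kap c = 0 ->
  X c * y ^ k = v ^ (- (lam u c * 2 * k)) * (y ^ k * X c).
Proof.
move=> kc.
have pos (n : nat) : X c * y ^+ n = v ^ (- (lam u c * 2 * n%:Z)) * (y ^+ n * X c).
  elim: n => [|n IHn]; first by rewrite !expr0 mulr1 mulr0 oppr0 expr0z !mul1r.
  rewrite exprS mulrA y_comm1 // -!mulrA IHn mulvCA mulvA; congr (v ^ _ * _); lia.
case: k => n; first exact: pos.
have yn_unit : y ^+ n.+1 \is a GRing.unit by rewrite unitrX.
rewrite NegzE -exprnN; apply: (mulIr yn_unit); rewrite mulrVK //.
rewrite -!mulrA pos mulvCA mulvA mulKr //.
by rewrite (_ : _ - _ = 0) ?expr0z ?mul1r //; ring.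
Qed.

Lemma frame_mut_exists : exists Z, frame_mut kap u b d h X Z.
Proof.
(* Writing [c] as [- kap c] times [u] plus a vector with [kap] zero forces this value: [Z u] has to
   be [y], and the power of [v] normalises the product of the two factors. *)
pose Z c := v ^ (kap c * lam u c) * (y ^ (- kap c) * X (c + u *~ kap c)).
have lamz a (c e : V) : lam e (c *~ a) = lam e c * a.
  by rewrite raddfMz -mulrzr intz.
have kapz (a : int) : kap (u *~ a) = - a by rewrite raddfMz ku -mulrzr intz mulN1r.
exists Z; split=> //.
- split=> [|c e]; first by rewrite /Z !form0 !mul0r expr0z oppr0 expr0z !mul1r addr0 (proj1 frX).
  rewrite /Z formD; set k := kap c; set l := kap e.
  have c0 : kap (c + u *~ k) = 0 by rewrite formD kapz addrN.
  rewrite mulvCA -!mulrA mulvA [X (c + _) * _]mulrA y_comm // -!mulrA (frameM frX).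
  rewrite (mulvCA _ (y ^ (- l))) !(mulvCA _ (y ^ (- k))) !mulvA [y ^ (- k) * _]mulrA.
  rewrite -exprzDr // -opprD.
  have -> : c + u *~ k + (e + u *~ l) = c + e + u *~ (k + l) by rewrite mulrzDr addrACA.
  congr (v ^ _ * _); rewrite !(lamDl, formD, lamz) ![lam (u *~ _) _]lam_skew !lamz lam_id.
  rewrite [lam e u]lam_skew [lam c u]lam_skew; ring.
- by move=> c kc; rewrite /Z kc mul0r expr0z oppr0 expr0z !mul1r mulr0z addr0.
- by rewrite /Z ku lam_id mulr0 expr0z mul1r opprK expr1z mulrN1z addrN (proj1 frX) mulr1.
Qed.

End Existence.

(** * The rank two exchange *)

Section RankTwo.
Variables (kap1 kap2 phi : {additive V -> int}) (u1 b1 u2 b2 : V).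
Variables (d1 d2 : nat) (h1 h2 : nat -> F).
Hypotheses (h1_coef : forall r, Zq v (h1 r)) (h2_coef : forall r, Zq v (h2 r)).
Hypothesis h1_0 : h1 0%N = 1.
Variables (X Y Z W : V -> F).
Hypothesis frX : is_frame X.
Hypothesis indX : independent X.
Hypothesis XZ : frame_mut kap1 u1 b1 d1 h1 X Z.
Hypothesis XY : frame_mut kap2 u2 b2 d2 h2 X Y.
Hypothesis ZW : frame_mut kap2 u2 b2 d2 h2 Z W.
Hypotheses (k2u1 : kap2 u1 = 0) (k1u2 : 0 <= kap1 u2).
Hypotheses (k2b1 : 0 <= kap2 b1) (k1b2 : kap1 b2 <= 0).
Hypothesis k2b1_0 : kap2 b1 = 0 -> kap1 b2 = 0.
Hypotheses (phib1 : 0 < phi b1) (phib2 : phi b2 = 0).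

Let frY := fm_frame XY.
Let frZ := fm_frame XZ.
Let frW := fm_frame ZW.
Local Notation tau := (ext X Z).

(** * The ring [D] of elements common to the tori of [X] and [Y], and its generators *)

Definition bitorus x := torus X x /\ torus Y x.

Lemma bitorus_0 : bitorus 0.
Proof. by split; apply: span_0. Qed.

Lemma bitorus_D x y : bitorus x -> bitorus y -> bitorus (x + y).
Proof. by case=> ? ? [? ?]; split; apply: span_D. Qed.

Lemma bitorus_N x : bitorus x -> bitorus (- x).
Proof. by case=> ? ?; split; apply: span_N. Qed.

Lemma bitorus_M x y : bitorus x -> bitorus y -> bitorus (x * y).
Proof. by case=> ? ? [? ?]; split; apply: torus_M. Qed.

Lemma bitorus_v a x : bitorus x -> bitorus (v ^ a * x).
Proof. by case=> ? ?; split; apply: span_v. Qed.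

Lemma bitorus_Y : bitorus (Y u2).
Proof. by split; [exact: (fm_var_torus h2_coef XY)|apply: span_X]. Qed.

Lemma bitorus_exp x k : bitorus x -> bitorus (x ^+ k).
Proof. by case=> ? ?; split; apply: torus_exp. Qed.

Lemma bitorus_X c : 0 <= kap2 c -> bitorus (X c).
Proof. by move=> kc; split; [apply: span_X|exact: (fm_old_in_new h2_coef frX XY)]. Qed.

Lemma bitorus_span x : span X (fun c => 0 <= kap2 c) x -> bitorus x.
Proof.
elim=> [|a c kc|? ? _ ? _ ?|? _ ?].
- exact: bitorus_0.
- exact/bitorus_v/bitorus_X.
- exact: bitorus_D.
- exact: bitorus_N.
Qed.

(* Polynomials in the [kap2]-variable and its mutation over the torus of the other
   variables; they exhaust the intersection of the two tori ([bitorus_mixed]). *)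
Inductive mixed : F -> Prop :=
  | mixed_0 : mixed 0
  | mixed_X a l c : 0 <= kap2 c -> mixed (v ^ a * (Y u2 ^+ l * X c))
  | mixed_D x y : mixed x -> mixed y -> mixed (x + y)
  | mixed_N x : mixed x -> mixed (- x).

Lemma mixed_bitorus x : mixed x -> bitorus x.
Proof.
elim=> [|a l c kc|? ? _ ? _ ?|? _ ?].
- exact: bitorus_0.
- apply/bitorus_v/bitorus_M; last exact: bitorus_X.
  exact/bitorus_exp/bitorus_Y.
- exact: bitorus_D.
- exact: bitorus_N.
Qed.

Lemma mixed_span l x : span X (fun c => 0 <= kap2 c) x -> mixed (Y u2 ^+ l * x).
Proof.
elim=> [|a c kc|y z _ ? _ ?|y _ ?].
- by rewrite mulr0; apply: mixed_0.
- by rewrite mulvCA; apply: mixed_X.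
- by rewrite mulrDr; apply: mixed_D.
- by rewrite mulrN; apply: mixed_N.
Qed.

Let deg k : pred V := fun c => kap2 c == k.

Lemma var_exp_span l : span X (fun c => kap2 c = - l%:Z) (Y u2 ^+ l).
Proof.
elim: l => [|l IHl].
  by rewrite expr0 -[1](proj1 frX); apply: span_X; rewrite form0.
rewrite exprS; apply: (span_M frX _ (fm_var_kap h2_coef XY) IHl).
by move=> e f; rewrite formD /=; lia.
Qed.

(** A criterion inside the torus of [X] for membership in the torus of [Y]: the part of
    [kap2]-degree [- l] is a left multiple of the [l]-th power of the new variable. *)
Definition divisible x := forall l : nat,
  exists2 g, span X (fun c => kap2 c = 0) g & pr X (deg (- l%:Z)) x = Y u2 ^+ l * g.

Lemma divisible_0 : divisible 0.
Proof. by move=> l; exists 0; [apply: span_0|rewrite mulr0 /pr (ext0 indX)]. Qed.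

(* [Y u2] is homogeneous of degree -1 for [kap2], so the expansion of [x] in the
   frame [Y] can be read off the homogeneous components of [Y u2 ^+ N * x]. *)
Lemma clear_denominators x : torus Y x -> exists N0, forall N : nat, (N0 <= N)%N ->
  torus X (Y u2 ^+ N * x) /\ divisible (Y u2 ^+ N * x).
Proof.
elim=> [|a c _|y z _ [N1 H1] _ [N2 H2]|y _ [N1 H1]].
- exists 0%N => N _; rewrite mulr0; split; [exact: span_0|exact: divisible_0].
- exists `|kap2 c|%N => N leN.
  (* [M] is chosen so that [Y u2 ^+ N * Y c] equals, up to a power of [v], [Y u2 ^+ M * X c0] with
     [c0] of degree zero. *)
  have [M eM] : exists M : nat, N%:Z - kap2 c = M%:Z.
    by exists `|N%:Z - kap2 c|%N; lia.
  pose c0 := c + u2 *+ N - u2 *+ M.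
  have kc0 : kap2 c0 = 0.
    rewrite /c0 formB formD !formMn (fm_u XY); lia.
  have [a' ->] : exists a', Y u2 ^+ N * (v ^ a * Y c) = Y u2 ^+ M * (v ^ a' * X c0).
    exists (a + lam (u2 *+ N) c - lam (u2 *+ M) c0).
    rewrite !mulvCA -(fm_eq XY) // !(frameX frY) !(frameM frY) !mulvA.
    by congr (v ^ _ * Y _); [ring|rewrite /c0 [RHS]addrC subrK addrC].
  have Sg : span X (fun c => kap2 c = 0) (v ^ a' * X c0) by apply: span_vX.
  have SM : span X (deg (- M%:Z)) (Y u2 ^+ M * (v ^ a' * X c0)).
    apply: (span_M frX _ (var_exp_span M) Sg) => e f.
    by rewrite /deg formD /=; lia.
  split=> [|k]; first exact: span_torus SM.
  have [->|kM] := eqVneq k M.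
    by exists (v ^ a' * X c0) => //; rewrite (pr_id indX SM).
  exists 0; first exact: span_0.
  rewrite mulr0; apply: (pr_0 indX); apply: span_mono SM => e.
  rewrite /deg; lia.
- exists (maxn N1 N2) => N; rewrite geq_max => /andP [/H1 [T1 D1] /H2 [T2 D2]].
  rewrite mulrDr; split=> [|l]; first exact: span_D.
  have [g1 S1 E1] := D1 l; have [g2 S2 E2] := D2 l.
  by exists (g1 + g2); [apply: span_D|rewrite /pr (extD indX) // -/(pr _ _) E1 E2 mulrDr].
- exists N1 => N /H1 [T1 D1].
  rewrite mulrN; split=> [|l]; first exact: span_N.
  have [g1 S1 E1] := D1 l.
  by exists (- g1); [apply: span_N|rewrite /pr (extN indX) // -/(pr _ _) E1 mulrN].
Qed.

(** Multiplication by [Y u2 ^+ N] shifts degrees by [- N], so divisibility by [Y u2 ^+ (N + l)]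
    after clearing denominators cancels to divisibility by [Y u2 ^+ l]. *)
Lemma bitorus_divisible x : bitorus x -> divisible x.
Proof.
case=> Tx /clear_denominators [N /(_ N (leqnn N)) [TN DN]] l.
have [g Sg Eg] := DN (N + l)%N; exists g => //.
apply: (mulrI (unitrX N (fm_unit XY))).
rewrite mulrA -exprD -Eg; apply/esym.
apply: (prM frX indX _ (var_exp_span N) Tx) => e f.
by rewrite /deg formD /=; lia.
Qed.

(** Peel off the component of lowest negative degree, which has mixed form by divisibility, until no
    negative degree is left. *)
Lemma divisible_mixed x : torus X x -> divisible x -> mixed x.
Proof.
move=> Tx; have [t [K St]] := span_bounded kap2 Tx.
have [l Sl] : exists l : nat, span X (fun c => - l%:Z <= kap2 c) x.
  by exists `|t|%N; apply: span_mono St => c []; lia.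
elim: l x {Tx t K St} Sl => [|l IHl] x Sl Dx.
  by rewrite -[x]mul1r -(expr0 (Y u2)); apply/mixed_span/(span_mono _ Sl) => c; lia.
have Tx := span_torus Sl; have [g Sg Eg] := Dx l.+1.
have Tp := pr_torus indX (deg (- l.+1%:Z)) Tx.
rewrite -(subrK (pr X (deg (- l.+1%:Z)) x) x); apply: mixed_D; last first.
  by rewrite Eg; apply/mixed_span/(span_mono _ Sg) => c ->.
apply: IHl => [|k].
  by apply: span_mono (pr_compl indX (deg (- l.+1%:Z)) Sl) => c []; rewrite /deg; lia.
have prpr : span X (deg (- l.+1%:Z)) (pr X (deg (- l.+1%:Z)) x).
  by apply: span_mono (pr_span indX (deg (- l.+1%:Z)) Tx) => c [].
rewrite /pr (extB indX) // -!/(pr _ _ _); have [->|kl] := eqVneq k l.+1.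
  exists 0; first exact: span_0.
  by rewrite (pr_id indX prpr) subrr mulr0.
have [g' Sg' ->] := Dx k; exists g' => //.
rewrite [X in _ - X](pr_0 indX) ?subr0 //; apply: span_mono prpr => c; rewrite /deg; lia.
Qed.

Lemma bitorus_mixed x : bitorus x -> mixed x.
Proof. by move=> Dx; apply: divisible_mixed (bitorus_divisible Dx); case: Dx. Qed.

(** As [phi b2 = 0], the variable [Y u2] is homogeneous for [phi]; so are the generators of mixed
    form, and [D] is graded. *)
Lemma bitorus_pr t x : bitorus x -> bitorus (pr X (fun c => phi c == t) x).
Proof.
move=> /bitorus_mixed; elim=> [|a l c kc|y z My IHy Mz IHz|y My IHy].
- by rewrite /pr (ext0 indX); apply: bitorus_0.
- have Me := mixed_bitorus (mixed_X a l kc).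
  have Se : span X (fun e => phi e = phi u2 *+ l + phi c) (v ^ a * (Y u2 ^+ l * X c)).
    apply: span_v; apply: (span_M frX (P := fun e => phi e = phi u2 *+ l)
      (Q := fun e => phi e = phi c)) => [e f|| ].
    - by rewrite formD => -> ->.
    - elim: l {Me} => [|l IHl].
        by rewrite expr0 -[1](proj1 frX); apply: span_X; rewrite form0.
      rewrite exprS; apply: (span_M frX (P := fun e => phi e = phi u2) _ _ IHl) => [e f|].
        by rewrite formD mulrS => -> ->.
      rewrite (fm_var XY).
      apply: (span_sum (f := fun r => h2 r * X (u2 + b2 *+ r))) => r _.
      by apply: span_Zq => //; apply: span_X; rewrite formD formMn phib2 mul0r addr0.
    - exact: span_X.
  have [<-|ne] := eqVneq (phi u2 *+ l + phi c) t.
    by rewrite (pr_id indX) //; apply: span_mono Se => e ->.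
  rewrite (pr_0 indX); first exact: bitorus_0.
  by apply: span_mono Se => e ->.
- have [[Ty _] [Tz _]] := (mixed_bitorus My, mixed_bitorus Mz).
  by rewrite /pr (extD indX) //; apply: bitorus_D.
- have [Ty _] := mixed_bitorus My.
  by rewrite /pr (extN indX) //; apply: bitorus_N.
Qed.

(** * The map [tau] on the ring [D] *)

Lemma bitorus_Z1 : bitorus (Z u1).
Proof.
rewrite (fm_var XZ); apply: (big_ind bitorus) => [||r _].
- exact: bitorus_0.
- exact: bitorus_D.
apply: bitorus_span; apply: span_Zq => //; apply: span_X.
by rewrite formD formMn k2u1; nia.
Qed.

Lemma bitorus_low c : kap1 c <= 0 -> 0 <= kap2 c -> bitorus (Z c).
Proof.
move=> k1c k2c; pose k := absz (kap1 c).
have -> : c = u1 *+ k + (c - u1 *+ k) by rewrite addrC subrK.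
rewrite (frameD frZ) -(frameX frZ); apply/bitorus_v/bitorus_M.
  exact/bitorus_exp/bitorus_Z1.
rewrite (fm_eq XZ); last by rewrite formB formMn (fm_u XZ) /k; lia.
by apply: bitorus_X; rewrite formB formMn k2u1; lia.
Qed.

(** The exchange relations for [Y] over [X] and for [W] over [Z] share [u2], [b2] and [h2]. *)
Lemma tau_var : tau (Y u2) = W u2.
Proof.
rewrite (fm_var XY) (@ext_sum X indX Z d2.+1 (fun r => h2 r * X (u2 + b2 *+ r))).
  rewrite (fm_var ZW); apply: eq_bigr => r _.
  by rewrite (ext_Zq indX) ?(extX indX) //; apply: span_X.
by move=> r _; apply: span_Zq => //; apply: span_X.
Qed.

(* For [kap2 b1 > 0] the point is that [Z c] and [X c] agree modulo the monomials of
   higher degree in the [kap2]-variable. *)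
Lemma bitorus_shifted_var : exists M : nat, bitorus (Z u1 ^+ M * W u2).
Proof.
(* With this [M] the exponent of the [r]-th term has [kap1] equal to [kap1 b2 * r], which is never
   positive. *)
pose M := absz (kap1 u2); exists M; rewrite (frameX frZ).
rewrite -[_ * _](subrK (X (u1 *+ M) * Y u2)); apply: bitorus_D; last first.
  apply: bitorus_M bitorus_Y; apply: bitorus_X; rewrite formMn k2u1; lia.
rewrite (fm_var XY) (fm_var ZW) !mulr_sumr -sumrB.
apply: (big_ind bitorus) => [||r _]; [exact: bitorus_0|exact: bitorus_D|].
rewrite !mulrA -!(Zq_comm v_central _ (h2_coef r)) -!mulrA -mulrBr.
rewrite (frameM frZ) (frameM frX) -mulrBr.
set c := u1 *+ M + _.
have k1c : kap1 c = kap1 b2 * r%:Z.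
  by rewrite /c !formD !formMn (fm_u XZ) /M; lia.
have k2c : kap2 c = -1.
  by rewrite /c !formD !formMn k2u1 (fm_u XY) (fm_b XY); lia.
apply: bitorus_span; apply: span_Zq => //; apply: span_v.
have [/k2b1_0 k1b20|k2b1_neq0] := eqVneq (kap2 b1) 0.
  by rewrite (fm_eq XZ) ?subrr; [apply: span_0|rewrite k1c k1b20 mul0r].
have k2b1_gt0 : 0 < kap2 b1 by lia.
have k1c_le0 : kap1 c <= 0 by rewrite k1c; nia.
apply: span_mono (fm_lowest h1_coef frX XZ h1_0 k2b1_gt0 k1c_le0) => e.
rewrite k2c; lia.
Qed.

(** [kap2 u1 = 0] gives [lam u1 b2 = 0], so all terms of [W u2] commute with [Z u1 ^+ N] up to the
    same power of [v]. *)
Lemma Z1_var_comm N : exists a, Z u1 ^+ N * W u2 = v ^ a * (W u2 * Z u1 ^+ N).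
Proof.
rewrite (frameX frZ); exists (lam (u1 *+ N) u2 *+ 2).
rewrite (fm_var ZW) mulr_sumr mulr_suml mulr_sumr; apply: eq_bigr => r _.
rewrite mulrA -(Zq_comm v_central _ (h2_coef r)) -!mulrA -mulvCA; congr (_ * _).
rewrite !(frameM frZ) mulvA; congr (v ^ _ * Z _); last exact: addrC.
have u1b2 : lam u1 b2 = 0 by apply: (fm_lam XY).
rewrite [lam (_ + _) _]lam_skew formD formMn !lamMnl u1b2; ring.
Qed.

(* [tau] need not map the bitorus to itself, as it introduces negative powers of
   [Z u1]; membership up to such powers is all that survives. *)
Definition shiftable x := exists N0 : nat, forall N : nat, (N0 <= N)%N ->
  bitorus (Z u1 ^+ N * x).

Lemma shiftable_D x y : shiftable x -> shiftable y -> shiftable (x + y).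
Proof.
move=> [N1 H1] [N2 H2]; exists (maxn N1 N2) => N; rewrite geq_max => /andP [? ?].
by rewrite mulrDr; apply: bitorus_D; auto.
Qed.

Lemma shiftable_N x : shiftable x -> shiftable (- x).
Proof.
by move=> [N0 H]; exists N0 => N ?; rewrite mulrN; apply: bitorus_N; auto.
Qed.

(** [M] of the factors [Z u1] bring [W u2] into [D]; the others commute past it up to a power of [v]
    and act on [x]. *)
Lemma shiftable_var x : shiftable x -> shiftable (W u2 * x).
Proof.
have [M HM] := bitorus_shifted_var.
move=> [N0 H]; exists (M + N0)%N => N leN.
have -> : N = (M + (N - M))%N by lia.
have [a eq_a] := Z1_var_comm (N - M).
rewrite exprD -mulrA [Z u1 ^+ _ * (W u2 * x)]mulrA eq_a -!mulrA mulvCA.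
rewrite [Z u1 ^+ M * (W u2 * _)]mulrA; apply/bitorus_v/bitorus_M => //.
by apply: H; lia.
Qed.

Lemma shiftable_tau x : mixed x -> shiftable (tau x).
Proof.
elim=> [|a l c kc|y z My IHy Mz IHz|y My IHy].
- by exists 0%N => N _; rewrite (ext0 indX) mulr0; apply: bitorus_0.
- have Tvar : torus X (Y u2) by case: bitorus_Y.
  have Tc : torus X (X c) by apply: span_X.
  have Tl : torus X (Y u2 ^+ l) by apply: torus_exp.
  rewrite (extv indX); last exact: torus_M.
  rewrite (extM frX indX) // (ext_exp frX indX) // tau_var (extX indX).
  have [N0 H] : shiftable (W u2 ^+ l * Z c).
    elim: l {Tl} => [|l IHl]; last by rewrite exprS -mulrA; apply: shiftable_var.
    rewrite expr0 mul1r; exists (absz (kap1 c)) => N leN.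
    rewrite (frameX frZ) (frameM frZ); apply/bitorus_v/bitorus_low.
      by rewrite formD formMn (fm_u XZ); lia.
    by rewrite formD formMn k2u1; lia.
  by exists N0 => N /H HN; rewrite mulvCA; apply: bitorus_v.
- have [[Ty _] [Tz _]] := (mixed_bitorus My, mixed_bitorus Mz).
  by rewrite (extD indX) //; apply: shiftable_D.
- have [Ty _] := mixed_bitorus My.
  by rewrite (extN indX) //; apply: shiftable_N.
Qed.

(** A generator [Y u2 ^+ l * X c] goes to [W u2 ^+ l * Z c], and [Z c] with [0 <= kap2 c] lies in
    the torus of [W]. *)
Lemma torus_tau x : mixed x -> torus W (tau x).
Proof.
elim=> [|a l c kc|y z My IHy Mz IHz|y My IHy].
- by rewrite (ext0 indX); apply: span_0.
- have Tvar : torus X (Y u2) by case: bitorus_Y.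
  have Tc : torus X (X c) by apply: span_X.
  have Tl : torus X (Y u2 ^+ l) by apply: torus_exp.
  rewrite (extv indX); last exact: torus_M.
  rewrite (extM frX indX) // (ext_exp frX indX) // tau_var (extX indX).
  apply: span_v; apply: torus_M => //; last exact: (fm_old_in_new h2_coef frZ ZW).
  by apply: torus_exp => //; apply: span_X.
- have [[Ty _] [Tz _]] := (mixed_bitorus My, mixed_bitorus Mz).
  by rewrite (extD indX) //; apply: span_D.
- have [Ty _] := mixed_bitorus My.
  by rewrite (extN indX) //; apply: span_N.
Qed.

(** After multiplication by a suitable [X g], [tau] preserves the lowest layer; that layer of the
    image lies in [D] because [D] is graded, and [X g] is invertible in [D]. *)
Lemma lowest_layer_bitorus t x :
  span X (fun c => t <= phi c) x -> shiftable (tau x) ->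
  bitorus (pr X (fun c => phi c == t) x).
Proof.
move=> Sx [N1 H1]; have Tx := span_torus Sx.
have [t0 [K St]] := span_bounded kap1 Sx.
(* [N] meets two demands: [Z u1 ^+ N * tau x] lies in [D], and every exponent of [X g * x] has
   [kap1 <= 0]. *)
pose N := (N1 + absz t0 + K)%N; pose g := u1 *+ N; pose s := phi g + t.
have Shat : span X (fun c => kap1 c <= 0 /\ s <= phi c) (X g * x).
  apply: (span_M frX _ (@span_X X (fun e => e = g) _ erefl) St) => e c -> [].
  by rewrite /s !formD /g !formMn (fm_u XZ) /N; lia.
have [_ lowE] := ext_lowest h1_coef frX XZ h1_0 indX phib1 Shat.
have : bitorus (pr X (fun c => phi c == s) (X g * x)).
  rewrite -lowE; apply: bitorus_pr.
  rewrite (extM frX indX) // ?(extX indX) /g; last exact: span_X.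
  by rewrite -(frameX frZ); apply: H1; rewrite /N; lia.
rewrite (prM frX indX (P := fun e => e = g) (Q := fun c => phi c == t)) //; last exact: span_X.
  move=> Bg; rewrite -[pr _ _ _]mul1r -(frameN frX g) -mulrA.
  apply: bitorus_M => //; apply: bitorus_X.
  by rewrite formN /g formMn k2u1; lia.
by move=> e f ->; rewrite formD /s; lia.
Qed.

(** Induction on the number of [phi]-layers: the lowest one lies in [D], its image lies in the torus
    of [W], and its removal keeps the image of the remainder shiftable. *)
Lemma shiftable_torus x : torus X x -> shiftable (tau x) -> torus W (tau x).
Proof.
move=> Tx; have [t [K]] := span_bounded phi Tx.
move=> /(span_mono (Q := fun c => t <= phi c < t + K%:Z)) Sx.
have {Sx} : span X (fun c => t <= phi c < t + K%:Z) x by apply: Sx => c [].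
elim: K t x {Tx} => [|K IHK] t x Sx shx.
  rewrite (span_empty _ Sx) ?(ext0 indX); [exact: span_0|].
  by move=> c; lia.
have Sx' : span X (fun c => t <= phi c) x by apply: span_mono Sx => c; lia.
have Tx := span_torus Sx.
have Bt := lowest_layer_bitorus Sx' shx; have Mt := bitorus_mixed Bt.
set xt := pr _ _ _ in Bt Mt.
have Txt : torus X xt by case: Bt.
have Td : torus X (x - xt) by apply: span_B.
rewrite -(subrK xt x) (extD indX) //; apply: span_D; last exact: torus_tau.
apply: (IHK (t + 1)).
  by apply: span_mono (pr_compl indX (fun c => phi c == t) Sx) => c; lia.
rewrite (extB indX) //; apply: shiftable_D => //.
by apply: shiftable_N; apply: shiftable_tau.
Qed.

Lemma torus_preimage x : torus Z x -> exists2 y, torus X y & tau y = x.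
Proof.
elim=> [|a c _|_ _ _ [y Ty <-] _ [z Tz <-]|_ _ [y Ty <-]].
- by exists 0; [apply: span_0|rewrite (ext0 indX)].
- by exists (v ^ a * X c); [apply: span_vX|rewrite (extvX indX)].
- by exists (y + z); [apply: span_D|rewrite (extD indX)].
- by exists (- y); [apply: span_N|rewrite (extN indX)].
Qed.

Theorem rank_two x : torus X x -> torus Y x -> torus Z x -> torus W x.
Proof.
move=> Xx Yx /torus_preimage [y Ty xE]; rewrite -xE.
(* The bound [0] suffices, as [x] and [Z u1] both lie in [D]. *)
apply: shiftable_torus => //; exists 0%N => N _; rewrite xE.
by apply: bitorus_M; [apply/bitorus_exp/bitorus_Z1|split].
Qed.

End RankTwo.
End Frames.

(** * Mutation of quantum seeds *)

Section ExchangeMatrices.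
Variables (F : unitRingType) (m n : nat) (nm : (n <= m)%N).

Definition form (L : 'M[int]_m) (a b : 'cV[int]_m) : int := lam L a b.

Definition coord (k : 'I_m) (c : 'cV[int]_m) : int := c k ord0.

Lemma form_is_additive L a : zmod_morphism (form L a).
Proof. by move=> b c; rewrite /form /lam mulmxBr !mxE. Qed.

Lemma coord_is_additive k : zmod_morphism (coord k).
Proof. by move=> b c; rewrite /coord !mxE. Qed.

HB.instance Definition _ L a :=
  GRing.isZmodMorphism.Build 'cV[int]_m int (form L a) (form_is_additive L a).
HB.instance Definition _ k :=
  GRing.isZmodMorphism.Build 'cV[int]_m int (coord k) (coord_is_additive k).

Definition formA L a : {additive 'cV[int]_m -> int} := form L a.
Definition coordA k : {additive 'cV[int]_m -> int} := coord k.

Local Notation wi := (widen_ord nm).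

Lemma form_skew L : L^T = - L -> forall a b, form L b a = - form L a b.
Proof.
move=> skewL a b; rewrite /form /lam.
have -> : b^T *m L *m a = (a^T *m L^T *m b)^T by rewrite !trmx_mul !trmxK mulmxA.
by rewrite skewL mxE mulmxN mulNmx mxE.
Qed.

Lemma form_conj (L E : 'M[int]_m) a b : form (E^T *m L *m E) a b = form L (E *m a) (E *m b).
Proof. by rewrite /form /lam trmx_mul !mulmxA. Qed.

Lemma formZr L a k b : form L a (k *: b) = k * form L a b.
Proof. by rewrite /form /lam -scalemxAr mxE. Qed.

Lemma formZl L a k b : form L (k *: a) b = k * form L a b.
Proof. by rewrite /form /lam linearZ /= -!scalemxAl mxE. Qed.

Lemma ev_entry (k : 'I_m) (l : nat) : ev m l k ord0 = ((k : nat) == l)%:Z.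
Proof. by rewrite mxE. Qed.

Lemma coord_ev (k : 'I_m) (l : nat) : coord k (ev m l) = ((k : nat) == l)%:Z.
Proof. exact: ev_entry. Qed.

Lemma ev_delta (k : 'I_m) : ev m k = delta_mx k ord0.
Proof.
apply/colP => l; rewrite !mxE eqxx andbT.
by case: (eqVneq l k) => [->|/negbTE E]; rewrite ?eqxx // -[LHS]/((l == k)%:Z) E.
Qed.

Lemma form_ev L (k l : 'I_m) : form L (ev m k) (ev m l) = L k l.
Proof.
by rewrite /form /lam !ev_delta trmx_delta -rowE -colE !mxE.
Qed.

Lemma form_ext (L L' : 'M[int]_m) : (forall a b, form L a b = form L' a b) -> L = L'.
Proof. by move=> eqL; apply/matrixP => k l; rewrite -form_ev eqL form_ev. Qed.

Lemma col_mulmx p q r (A : 'M[int]_(p, q)) (B : 'M[int]_(q, r)) j :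
  col j (A *m B) = A *m col j B.
Proof. by apply/colP => k; rewrite !mxE; apply: eq_bigr => l _; rewrite mxE. Qed.

Section OneSeed.
Variables (S : seed F m n) (D : 'I_n -> int).
Hypothesis skewL : (sL S)^T = - sL S.
Hypothesis D_gt0 : forall j, 0 < D j.
Hypothesis LB : forall (k : 'I_m) (j : 'I_n),
  (sL S *m sB S) k j = if (k : nat) == (j : nat) then - D j else 0.

Lemma form_col c j : form (sL S) c (col j (sB S)) = - (D j * coord (wi j) c).
Proof.
rewrite /form /lam -mulmxA -col_mulmx mxE.
under eq_bigr => k _ do rewrite [X in X * _]mxE [X in _ * X]mxE LB.
rewrite (bigD1 (wi j)) //= big1 => [|k neq_kj]; first by rewrite eqxx /coord; lia.
have -> : (k == j :> nat) = false by apply/negbTE.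
by rewrite mulr0.
Qed.

(** Evaluate the skew form on the columns [i] and [j] in both orders. *)
Lemma exchange_skew i j : D i * sB S (wi i) j = - (D j * sB S (wi j) i).
Proof.
have := form_skew skewL (col i (sB S)) (col j (sB S)).
rewrite !form_col /coord !mxE; lia.
Qed.

Lemma exchange_diag i : sB S (wi i) i = 0.
Proof. by have := exchange_skew i i; have := D_gt0 i; nia. Qed.

Lemma coord_col i : coord (wi i) (col i (sB S)) = 0.
Proof. by rewrite /coord mxE exchange_diag. Qed.

Lemma EmatE i eps (c : 'cV[int]_m) k : (Emat S i eps *m c) k ord0 =
  if k == wi i then - c k ord0
  else c k ord0 + Num.max (- (sgn eps * sB S k i)) 0 * c (wi i) ord0.
Proof.
rewrite mxE (bigD1 (wi i)) //= mxE eqxx.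
have [->|neq_ki] := eqVneq k (wi i).
  rewrite eqxx big1 ?addr0 ?mulN1r // => l neq_li; rewrite mxE.
  have -> : (l == i :> nat) = false by apply/negbTE.
  by rewrite eq_sym (negbTE neq_li) mul0r.
have -> : (k == i :> nat) = false by apply/negbTE.
rewrite (bigD1 k) //= mxE eqxx.
have -> : (k == i :> nat) = false by apply/negbTE.
rewrite mul1r big1 ?addr0 1?addrC // => l /andP [neq_li neq_lk]; rewrite mxE.
have -> : (l == i :> nat) = false by apply/negbTE.
by rewrite eq_sym (negbTE neq_lk) mul0r.
Qed.

Lemma coord_Emat i eps (c : 'cV[int]_m) : coord (wi i) (Emat S i eps *m c) = - coord (wi i) c.
Proof. by rewrite /coord EmatE eqxx. Qed.

Lemma Emat_id i eps c : coord (wi i) c = 0 -> Emat S i eps *m c = c.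
Proof.
rewrite /coord => ci0; apply/colP => k; rewrite EmatE ci0 mulr0 addr0.
by case: eqP => // ->; rewrite ci0 oppr0.
Qed.

Lemma EmatK i eps (c : 'cV[int]_m) : Emat S i eps *m (Emat S i eps *m c) = c.
Proof.
apply/colP => k; rewrite !EmatE eqxx; case: eqP => [->|_]; first by rewrite opprK.
by rewrite mulrN addrK.
Qed.

Lemma Emat_sq i eps : Emat S i eps *m Emat S i eps = 1%:M.
Proof.
apply/matrixP => k l; have := EmatK i eps (delta_mx l ord0).
move/colP/(_ k); rewrite mulmxA -colE mxE => ->.
by rewrite !mxE andbT.
Qed.

(** From [[x]_+ - [- x]_+ = x]: the two signs differ by a transvection along column [i]. *)
Lemma Emat_negb i eps (c : 'cV[int]_m) : Emat S i (~~ eps) *m c =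
  Emat S i eps *m c + (sgn eps * coord (wi i) c) *: col i (sB S).
Proof.
apply/colP => k; rewrite [RHS]mxE !EmatE !mxE /coord.
case: eqP => [->|_]; first by rewrite exchange_diag mulr0 addr0.
have -> : Num.max (- (sgn (~~ eps) * sB S k i)) 0 =
    Num.max (- (sgn eps * sB S k i)) 0 + sgn eps * sB S k i.
  by case: (eps); rewrite /sgn /=; lia.
ring.
Qed.

(** The correction terms along column [i] cancel, because that column pairs with a vector only
    through its [i]-th coordinate. *)
Lemma form_Emat_eps i eps a b :
  form (sL S) (Emat S i (~~ eps) *m a) (Emat S i (~~ eps) *m b) =
  form (sL S) (Emat S i eps *m a) (Emat S i eps *m b).
Proof.
rewrite !Emat_negb; set a' := _ *m a; set b' := _ *m b.
have addl x y z : form (sL S) (x + y) z = form (sL S) x z + form (sL S) y z.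
  by rewrite ![form _ _ z](form_skew skewL) raddfD opprD.
rewrite addl !(raddfD (form _ _)) /= !formZl !formZr.
by rewrite [form _ (col i _) b'](form_skew skewL) !form_col coord_col !coord_Emat; ring.
Qed.

Lemma BF_col i eps l : col l (sB S *m Fmat nm S i eps) =
  if l == i then - col i (sB S)
  else col l (sB S) + Num.max (sgn eps * sB S (wi i) l) 0 *: col i (sB S).
Proof.
apply/colP => k; rewrite !mxE (bigD1 i) //= mxE eqxx.
have [->|neq_li] := eqVneq l i.
  rewrite big1 ?addr0 => [|j neq_ji]; first by rewrite !mxE mulrN1.
  by rewrite mxE (negbTE neq_ji) mulr0.
rewrite (bigD1 l) //= big1 ?addr0 => [|j /andP [neq_ji neq_jl]]; last first.
  by rewrite mxE (negbTE neq_ji) (negbTE neq_jl) mulr0.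
by rewrite !mxE (negbTE neq_li) eqxx mulr1 addrC mulrC.
Qed.

Lemma EBF_col i eps l : col l (Emat S i eps *m sB S *m Fmat nm S i eps) =
  if l == i then - col i (sB S)
  else Emat S i eps *m col l (sB S) +
       Num.max (sgn eps * sB S (wi i) l) 0 *: col i (sB S).
Proof.
rewrite -mulmxA col_mulmx BF_col.
have Ei : Emat S i eps *m col i (sB S) = col i (sB S).
  exact/Emat_id/coord_col.
by case: eqP => _; [rewrite mulmxN Ei|rewrite mulmxDr -scalemxAr Ei].
Qed.

(** For [l != i], changing the sign adds to column [l] a multiple of column [i] through [Emat] and
    removes the same multiple through [Fmat]. *)
Lemma EBF_eps i eps : Emat S i (~~ eps) *m sB S *m Fmat nm S i (~~ eps) =
  Emat S i eps *m sB S *m Fmat nm S i eps.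
Proof.
suff eq_col l : col l (Emat S i (~~ eps) *m sB S *m Fmat nm S i (~~ eps)) =
    col l (Emat S i eps *m sB S *m Fmat nm S i eps).
  by apply/matrixP => k l; have /colP/(_ k) := eq_col l; rewrite !mxE.
rewrite !EBF_col; case: eqP => // _; rewrite Emat_negb -addrA -scalerDl.
congr (_ + _ *: _); rewrite /coord mxE; case: eps; rewrite /sgn /=; lia.
Qed.

End OneSeed.
End ExchangeMatrices.

Section SeedMutation.
Variables (F : unitRingType) (v : F).
Hypothesis Fdiv : forall x : F, x != 0 -> x \is a GRing.unit.
Hypotheses (v_unit : v \is a GRing.unit) (v_central : forall x : F, v * x = x * v).
Variables (m n : nat) (nm : (n <= m)%N) (d : 'I_n -> nat) (h : 'I_n -> nat -> F).
Hypothesis d_pos : forall k, (0 < d k)%N.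
Hypothesis h_coef : forall k r, Zq v (h k r).
Hypothesis h_sym : forall k r, (r <= d k)%N -> h k r = h k (d k - r)%N.
Hypothesis h_0 : forall k, h k 0%N = 1.

Local Notation wi := (widen_ord nm).
Local Notation beta := (beta d).
Local Notation mutation := (mutation v nm d h).
Local Notation is_qseed := (is_qseed v d).

(** [X 0] is idempotent, and nonzero by independence, hence [1] in a division ring. *)
Lemma frame_of_independent (L : 'M[int]_m) X :
  qcomm v L X -> independent v X -> is_frame v (formA L) X.
Proof.
move=> qX indX; split=> //.
have X0 : X 0 != 0.
  apply/eqP => X0; have := indX [:: (0, 0)] (fun _ => 1) isT.
  rewrite big_seq1 /= X0 mulr0 => /(_ erefl (0, 0)); rewrite inE eqxx => /(_ isT).
  by move/eqP; rewrite oner_eq0.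
apply: (mulrI (Fdiv X0)); rewrite mulr1 qX addr0.
by rewrite -/(form L 0 0) (raddf0 (form L 0)) expr0z mul1r.
Qed.

(** * Frames of quantum seeds and the exchange polynomial *)

Section OneQSeed.
Variable S : seed F m n.
Hypothesis qS : is_qseed S.

Lemma qseed_skew a b : formA (sL S) b a = - formA (sL S) a b.
Proof. by apply: form_skew; case: qS. Qed.

Lemma qseed_indep : independent v (sX S).
Proof. by case: qS. Qed.

Lemma qseed_frame : is_frame v (formA (sL S)) (sX S).
Proof. by apply: frame_of_independent qseed_indep; case: qS. Qed.

Lemma beta_entry k j : sB S k j = (d j)%:Z * beta S j k ord0.
Proof. by case: qS => _ _ dvd _ _; rewrite mxE mulrC divzK. Qed.

Lemma beta_col j : col j (sB S) = (d j)%:Z *: beta S j.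
Proof. by apply/colP => k; rewrite mxE beta_entry [RHS]mxE. Qed.

Lemma form_beta : exists2 D : 'I_n -> int, (forall j, 0 < D j) &
  forall c j, (d j)%:Z * form (sL S) c (beta S j) = - (D j * coord (wi j) c).
Proof.
case: qS => _ [D [D_gt0 LB]] _ _ _; exists D => // c j.
by rewrite -formZr -beta_col; apply: form_col.
Qed.

Lemma form_beta_0 c j : coord (wi j) c = 0 -> form (sL S) c (beta S j) = 0.
Proof.
by have [D _ E] := form_beta; move=> cj; have := E c j; have := d_pos j; rewrite cj; nia.
Qed.

Lemma coord_beta i : coord (wi i) (beta S i) = 0.
Proof.
case: qS => skewL [D [D_gt0 LB]] _ _ _.
have := exchange_diag nm skewL D_gt0 LB i; rewrite beta_entry /coord.
by have := d_pos i; nia.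
Qed.

(** The relation [exchange_skew] with the factors [d] extracted; it serves to show that the two
    coordinates vanish together. *)
Lemma coord_beta_sign i j : exists2 Q : int * int, 0 < Q.1 /\ 0 < Q.2 &
  Q.1 * coord (wi i) (beta S j) = - (Q.2 * coord (wi j) (beta S i)).
Proof.
case: qS => skewL [D [D_gt0 LB]] _ _ _.
have := exchange_skew nm skewL LB i j; rewrite !beta_entry /coord => E.
exists (D i * (d j)%:Z, D j * (d i)%:Z) => /=; last by rewrite -!mulrA.
by have := D_gt0 i; have := D_gt0 j; have := d_pos i; have := d_pos j; split; nia.
Qed.

Lemma form_ev_beta (i : 'I_n) : 0 < form (sL S) (- ev m i) (beta S i).
Proof.
have [D D_gt0 E] := form_beta; have := E (- ev m i) i.
rewrite /coord mxE ev_entry eqxx; have := D_gt0 i; have := d_pos i; nia.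
Qed.

Lemma form_ev_beta_neq (i j : 'I_n) : i != j -> form (sL S) (- ev m i) (beta S j) = 0.
Proof.
move=> neq_ij; apply: form_beta_0; rewrite (raddfN (coord _)) /= coord_ev /=.
case: eqP => [E|]; last by rewrite oppr0.
by case/eqP: neq_ij; apply/val_inj.
Qed.

Definition tropical (i : 'I_n) (eps : bool) : 'cV[int]_m := Emat S i eps *m ev m i.

Definition signed_beta (i : 'I_n) (eps : bool) : 'cV[int]_m := sgn eps *: beta S i.

Lemma coord_signed_beta k i eps :
  coord k (signed_beta i eps) = sgn eps * coord k (beta S i).
Proof. by rewrite /coord mxE. Qed.

Lemma tropical_entry i eps k : coord k (tropical i eps) =
  if k == wi i then -1 else Num.max (- (sgn eps * sB S k i)) 0.
Proof.
rewrite /coord EmatE !ev_entry !eqxx; case: (eqVneq k (wi i)) => [->|neq_ki].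
  by rewrite eqxx.
have -> : (k == i :> nat) = false by apply/negbTE.
by rewrite add0r mulr1.
Qed.

(** [r [beta]_+ + (d - r) [- beta]_+ = d [- beta]_+ + r beta], so the exponents form an arithmetic
    progression; the other sign runs through it from the opposite end. *)
Lemma mutvarE i eps : mutvar d h S i =
  \sum_(r < (d i).+1) h i r * sX S (tropical i eps + signed_beta i eps *+ r).
Proof.
have bii := coord_beta i.
have entry k (r : nat) : (tropical i eps + signed_beta i eps *+ r) k ord0 =
    (d i)%:Z * Num.max (- (sgn eps * beta S i k ord0)) 0 - (k == wi i)%:Z
    + (sgn eps * beta S i k ord0) * r%:Z.
  rewrite -[LHS]/(coord k _) (raddfD (coord k)) /= tropical_entry beta_entry.
  have -> : coord k (signed_beta i eps *+ r) = (sgn eps * beta S i k ord0) * r%:Z.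
    by rewrite (raddfMn (coord k)) /= coord_signed_beta -mulr_natr natz.
  congr (_ + _); case: eqP => [->|_]; last rewrite subr0.
    by move: bii; rewrite /coord => ->; rewrite mulr0 oppr0 maxxx mulr0.
  rewrite mulrCA; set b := _ * beta S i k ord0; have := d_pos i.
  by case: (lerP 0 (- b)) => ?; nia.
case: eps entry => entry.
  apply: eq_bigr => r _; congr (_ * sX S _); apply/colP => k; rewrite entry.
  rewrite !mxE /sgn; set b := (sB S k i %/ _)%Z; have := ltn_ord r.
  rewrite (_ : (k == wi i) = (k == i :> nat)) //.
  by case: (lerP 0 b) => ?; nia.
(* For the negative sign the sum is reversed, [r] becoming [d i - r], which the symmetry of [h]
   permits. *)
rewrite [LHS](reindex_inj rev_ord_inj) /=; apply: eq_bigr => r _.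
have ltr := ltn_ord r; rewrite subSS -h_sym //; congr (_ * sX S _).
apply/colP => k; rewrite entry !mxE /sgn; set b := (sB S k i %/ _)%Z.
rewrite (_ : (k == wi i) = (k == i :> nat)) //.
by case: (lerP 0 b) => ?; nia.
Qed.

End OneQSeed.

(** Only basis vectors in the support of [c] are required, so that frames agreeing on part of the
    basis can be compared there. *)
Lemma vector_subgroup_ind (Q : 'cV[int]_m -> Prop) c :
  Q 0 -> (forall a b, Q a -> Q b -> Q (a + b)) -> (forall a, Q a -> Q (- a)) ->
  (forall k : 'I_m, coord k c != 0 -> Q (ev m k)) -> Q c.
Proof.
move=> Q0 QD QN Qev.
have -> : c = \sum_(k < m) (ev m k *~ coord k c).
  apply/colP => k; rewrite -[RHS]/(coord k _) (raddf_sum (coord k)) (bigD1 k) //= big1.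
    rewrite addr0 (raddfMz (coord k)) /= coord_ev eqxx.
    exact/esym/intz.
  move=> l neq_lk; rewrite (raddfMz (coord k)) /= coord_ev.
  have -> : (k == l :> nat) = false by apply/negbTE; rewrite eq_sym.
  by rewrite mul0rz.
have Qn (a : 'cV[int]_m) (j : nat) : Q a -> Q (a *+ j).
  by move=> Qa; elim: j => [|j IHj]; rewrite ?mulr0n // mulrS; apply: QD.
apply: (big_ind Q) => // k _; have [->|/Qev Qk] := eqVneq (coord k c) 0.
  by rewrite mulr0z.
case: (coord k c) => j; first exact: Qn.
by apply: QN; apply: Qn.
Qed.

Lemma frames_agree L (A B : 'cV[int]_m -> F) c :
  is_frame v (formA L) A -> is_frame v (formA L) B ->
  (forall a b, formA L b a = - formA L a b) ->
  (forall k : 'I_m, coord k c != 0 -> A (ev m k) = B (ev m k)) -> A c = B c.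
Proof.
move=> frA frB skewL agree.
apply: (@vector_subgroup_ind (fun c => A c = B c)) => // [|a b EA EB|a E].
- by rewrite (proj1 frA) (proj1 frB).
- by rewrite (frameD v_unit frA) (frameD v_unit frB) EA EB.
- by rewrite -(frameV v_unit skewL frA) -(frameV v_unit skewL frB) E.
Qed.

(** A mutation comes with some sign, but the mutated form and matrix do not depend on it; later
    arguments pick the sign that suits them. *)
Lemma mutation_any_sign S S' i : is_qseed S -> mutation i S S' -> forall eps,
  [/\ sL S' = (Emat S i eps)^T *m sL S *m Emat S i eps,
      sB S' = Emat S i eps *m sB S *m Fmat nm S i eps,
      qcomm v (sL S') (sX S'),
      (forall k : 'I_m, (k : nat) != (i : nat) -> sX S' (ev m k) = sX S (ev m k)) &
      sX S' (ev m i) = mutvar d h S i].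
Proof.
case=> skewL [D [D_gt0 LB]] _ _ _ [eps0 [EL EB qX Xk Xi]] eps.
have [->|neq_eps] := eqVneq eps eps0; first by split.
have {neq_eps} -> : eps = ~~ eps0 by move: neq_eps; case: (eps); case: (eps0).
split=> //; last by rewrite (EBF_eps nm skewL D_gt0 LB).
rewrite EL; apply: form_ext => a b; rewrite !form_conj.
by rewrite (form_Emat_eps nm skewL D_gt0 LB).
Qed.

(** * Seeds under one mutation *)

Section OneMutation.
Variables (S S' : seed F m n) (i : 'I_n).
Hypotheses (qS : is_qseed S) (mu : mutation i S S').

(** Reindexing by the involution [Emat] turns the form of [S'] back into that of [S]. *)
Definition twisted eps (c : 'cV[int]_m) : F := sX S' (Emat S i eps *m c).

Definition grading (i : 'I_n) eps : {additive 'cV[int]_m -> int} :=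
  formA (sL S) (sgn eps *: - ev m i).

Lemma sgn_sq eps : sgn eps * sgn eps = 1.
Proof. by case: eps. Qed.

Lemma grading_gt0 eps : 0 < grading i eps (signed_beta S i eps).
Proof.
by rewrite /grading /= /formA formZl formZr mulrA sgn_sq mul1r; apply: form_ev_beta.
Qed.

Lemma grading_eq0 j eps : i != j -> grading i eps (signed_beta S j eps) = 0.
Proof.
move=> neq_ij; rewrite /grading /= /formA formZl formZr mulrA sgn_sq mul1r.
exact: form_ev_beta_neq.
Qed.

Lemma mutvar_neq0 : mutvar d h S i != 0.
Proof.
rewrite (mutvarE qS i true).
apply: (binomial_neq0 v_unit (qseed_skew qS) _ _ (qseed_frame qS)) (grading_gt0 true) => //.
exact: qseed_indep.
Qed.

Lemma mutation_frame : is_frame v (formA (sL S')) (sX S').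
Proof.
have [EL _ qX _ Xi] := mutation_any_sign qS mu true.
split=> //; have := qX 0 (ev m i); rewrite add0r Xi.
have -> : lam (sL S') 0 (ev m i) = 0 by rewrite /lam trmx0 !mul0mx mxE.
rewrite expr0z; exact/mulIr/Fdiv/mutvar_neq0.
Qed.

Lemma twisted_frame eps : is_frame v (formA (sL S)) (twisted eps).
Proof.
have [X0 qX] := mutation_frame; have [EL _ _ _ _] := mutation_any_sign qS mu eps.
split=> [|c e]; first by rewrite /twisted mulmx0.
rewrite /twisted qX mulmxDr EL; congr (v ^ _ * _).
rewrite -[LHS]/(form _ _ _) form_conj !(EmatK nm) //.
Qed.

Lemma twisted_frame_mut eps :
  frame_mut v (formA (sL S)) (coordA (wi i)) (tropical S i eps) (signed_beta S i eps)
    (d i) (h i) (sX S) (twisted eps).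
Proof.
have [EL _ qX Xk Xi] := mutation_any_sign qS mu eps.
split.
- exact: twisted_frame.
- by rewrite /= tropical_entry eqxx.
- by rewrite /= coord_signed_beta coord_beta // mulr0.
- by move=> c ci; rewrite /= formZr form_beta_0 // mulr0.
- move=> c ci; apply: (frames_agree (twisted_frame eps) (qseed_frame qS) (qseed_skew qS)).
  move=> k ck; have neq_ki : k != wi i by apply: contraNneq ck => ->; apply/eqP.
  rewrite /twisted (Emat_id (nm := nm)) ?Xk // coord_ev.
  by have -> : (i == k :> nat) = false by apply/negbTE; rewrite eq_sym.
- by rewrite /twisted /tropical (EmatK nm) Xi (mutvarE qS i eps).
Qed.

Lemma mutation_independent : independent v (sX S').
Proof.
have indZ : independent v (twisted true).
  exact: (fm_independent v_unit v_central (qseed_skew qS) (h_coef i) (qseed_frame qS)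
    (twisted_frame_mut true) (h_0 i) (qseed_indep qS) (grading_gt0 true)).
move=> s z us sum0 p ps.
pose E (c : 'cV[int]_m) := Emat S i true *m c; have EK : involutive E := EmatK nm S i true.
pose g (q : int * 'cV[int]_m) := (q.1, E q.2).
have gK : involutive g by case=> a c; rewrite /g /= EK.
have := indZ [seq g q | q <- s] (z \o g); rewrite map_inj_uniq; last exact: inv_inj.
rewrite big_map; under eq_bigr => q _ do rewrite /= gK /twisted -/(E _) -/(E _) EK.
by move=> /(_ us sum0 (g p)); rewrite map_f //= gK; apply.
Qed.

Lemma mutation_col j eps : j != i -> sgn eps * sB S (wi i) j <= 0 ->
  col j (sB S') = Emat S i eps *m col j (sB S).
Proof.
case: (qS) => skewL [D [D_gt0 LB]] _ _ _ neq_ji sign.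
have [_ -> _ _ _] := mutation_any_sign qS mu eps.
rewrite (EBF_col nm skewL D_gt0 LB) (negbTE neq_ji).
by rewrite (max_idPr sign) scale0r addr0.
Qed.

Lemma mutation_col_i : col i (sB S') = - col i (sB S).
Proof.
case: (qS) => skewL [D [D_gt0 LB]] _ _ _.
have [_ -> _ _ _] := mutation_any_sign qS mu true.
by rewrite (EBF_col nm skewL D_gt0 LB) eqxx.
Qed.

(** Column by column: column [i] changes sign, and for every other column a sign is chosen for which
    it is simply transported by [Emat]. *)
Lemma mutation_qseed : is_qseed S'.
Proof.
case: (qS) => skewL [D [D_gt0 LB]] dvd qX indX.
have [EL EB qX' _ _] := mutation_any_sign qS mu true.
split=> //; last exact: mutation_independent.
- by rewrite EL !trmx_mul trmxK skewL mulNmx mulmxN mulmxA.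
- exists D; split=> // k j.
  have -> : (sL S' *m sB S') k j = form (sL S') (ev m k) (col j (sB S')).
    have -> : col j (sB S') = sB S' *m delta_mx j ord0 by rewrite colE.
    rewrite /form /lam.
    by rewrite ev_delta trmx_delta -mulmxA (mulmxA (sL S')) -rowE -colE [RHS]mxE [RHS]mxE.
  have target : - (D j * coord (wi j) (ev m k)) = if (k : nat) == j then - D j else 0.
    rewrite coord_ev eq_sym /=; case: eqP => _; lia.
  have [->|neq_ji] := eqVneq j i.
    have Ei : Emat S i true *m col i (sB S) = col i (sB S).
      by apply: (Emat_id (nm := nm)); apply: (coord_col nm skewL D_gt0 LB).
    rewrite mutation_col_i EL form_conj mulmxN Ei.
    rewrite (raddfN (form _ _)) /= (form_col nm LB) (coord_Emat nm).
    rewrite mulrN opprK.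
    rewrite coord_ev eq_sym /=; case: eqP => _; lia.
  have [eps sign] : exists eps, sgn eps * sB S (wi i) j <= 0.
    by case: (lerP (sB S (wi i) j) 0) => ?; [exists true|exists false]; rewrite /sgn; lia.
  have [{}EL _ _ _ _] := mutation_any_sign qS mu eps.
  rewrite (mutation_col neq_ji sign) EL form_conj (EmatK nm) (form_col nm LB) -target.
  congr (- (_ * _)); rewrite /coord EmatE.
  have neq_wij : (wi j == wi i) = false by apply/negbTE.
  rewrite neq_wij.
  (* The transposed entries have opposite signs, so with the chosen [eps] the [j]-th coordinate is
     kept. *)
  have -> : Num.max (- (sgn eps * sB S (wi j) i)) 0 = 0.
    apply/max_idPr; have := exchange_skew nm skewL LB i j.
    have := D_gt0 i; have := D_gt0 j.
    by move: sign; rewrite /sgn; case: (eps); nia.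
  by rewrite mul0r addr0.
- move=> k j; have [->|neq_ji] := eqVneq j i.
    have /colP/(_ k) := mutation_col_i; rewrite !mxE => ->.
    by rewrite rpredN.
  have [eps sign] : exists eps, sgn eps * sB S (wi i) j <= 0.
    by case: (lerP (sB S (wi i) j) 0) => ?; [exists true|exists false]; rewrite /sgn; lia.
  have /colP/(_ k) := mutation_col neq_ji sign; rewrite mxE EmatE !mxE => ->.
  case: eqP => [_|_]; first by rewrite rpredN.
  by apply: rpredD => //; apply: dvdz_mull.
Qed.

End OneMutation.

(** Column [i] changes sign under mutation, so [Emat] of [S'] with the opposite sign equals that of
    [S], which squares to the identity. *)
Lemma mutation_sym S S' i : is_qseed S -> mutation i S S' -> mutation i S' S.
Proof.
move=> qS mu; have qS' := mutation_qseed qS mu.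
have coli := mutation_col_i qS mu; have mue := mutation_any_sign qS mu true.
case: (qS) => skewL [D [D_gt0 LB]] _ qX _; case: mue => EL EB _ Xk Xi.
case: (qS') => skewL' [D' [D'_gt0 LB']] _ _ _.
have EE : Emat S' i false = Emat S i true.
  apply/matrixP => k l; rewrite !mxE; case: eqP => // _; case: eqP => // _.
  have /colP/(_ k) := coli; rewrite !mxE => ->; rewrite /sgn; congr (Num.max _ 0); lia.
have Ei : Emat S i true *m col i (sB S) = col i (sB S).
  by apply: (Emat_id (nm := nm)); apply: (coord_col nm skewL D_gt0 LB).
exists false; split=> //.
- by rewrite EE EL !mulmxA -trmx_mul (Emat_sq nm) trmx1 mul1mx -mulmxA (Emat_sq nm) mulmx1.
- suff eq_col l : col l (sB S) = col l (Emat S' i false *m sB S' *m Fmat nm S' i false).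
    by apply/matrixP => k l; have /colP/(_ k) := eq_col l; rewrite !mxE.
  rewrite (EBF_col nm skewL' D'_gt0 LB') coli.
  case: (eqVneq l i) => [->|neq_li]; first by rewrite opprK.
  have coll : col l (sB S') = Emat S i true *m col l (sB S) +
      Num.max (sB S (wi i) l) 0 *: col i (sB S).
    by rewrite EB (EBF_col nm skewL D_gt0 LB) (negbTE neq_li) /sgn mul1r.
  have -> : sB S' (wi i) l = - sB S (wi i) l.
    have /colP/(_ (wi i)) := coll; rewrite mxE => ->.
    by rewrite mxE EmatE eqxx !mxE (exchange_diag nm skewL D_gt0 LB) mulr0 addr0.
  rewrite EE coll mulmxDr (EmatK nm) -scalemxAr Ei scalerN /sgn mulN1r opprK.
  by rewrite addrK.
- by move=> k neq_ki; rewrite Xk.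
- rewrite (mutvarE qS' i false).
  have frm := twisted_frame_mut qS mu true.
  (* Here [g - u] is the basis vector [ev m i], so the old variable is expanded in the new frame. *)
  have := fm_involutive v_unit v_central (qseed_skew qS) (h_coef i) (qseed_frame qS) frm
    (g := ev m i + tropical S i true).
  rewrite addrK => ->; last first.
    by rewrite formD [LHS]/= coord_ev /= eqxx tropical_entry eqxx.
  apply: eq_bigr => r _; congr (_ * _); rewrite /twisted mulmxDr.
  have -> : signed_beta S' i false = signed_beta S i true.
    apply/colP => k; rewrite -[LHS]/(coord k _) -[RHS]/(coord k _) !coord_signed_beta.
    rewrite /coord /sgn mul1r mulN1r.
    have /colP/(_ k) := coli; rewrite mxE [RHS]mxE [in RHS]mxE.
    rewrite (beta_entry qS') (beta_entry qS); have := d_pos i; nia.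
  rewrite /tropical EE; congr (sX S' (_ + _)).
  apply: (Emat_id (nm := nm)); rewrite (raddfMn (coord _)) /= coord_signed_beta.
  by rewrite (coord_beta qS) mulr0 mul0rn.
Qed.

(** The upper bound quantifies over mutated seeds, so one must exist before membership in the torus
    of the mutation in direction [j] can be used. *)
Lemma mutation_exists S j : is_qseed S -> exists S', mutation j S S'.
Proof.
move=> qS.
have [Z frm] : exists Z, frame_mut v (formA (sL S)) (coordA (wi j)) (tropical S j true)
    (signed_beta S j true) (d j) (h j) (sX S) Z.
  apply: (frame_mut_exists Fdiv v_unit v_central (qseed_skew qS) (phi := grading S j true)).
  - exact: h_coef.
  - exact: h_0.
  - exact: qseed_frame.
  - exact: qseed_indep.
  - by rewrite /= tropical_entry eqxx.
  - by rewrite /= coord_signed_beta coord_beta // mulr0.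
  - by move=> c cj; rewrite /= formZr form_beta_0 // mulr0.
  - exact: grading_gt0.
exists (Seed (fun c => Z (Emat S j true *m c))
  ((Emat S j true)^T *m sL S *m Emat S j true)
  (Emat S j true *m sB S *m Fmat nm S j true)); exists true; split=> //=.
- move=> a b; rewrite (proj2 (fm_frame frm)) mulmxDr; congr (v ^ _ * _).
  by rewrite -[RHS]/(form _ _ _) form_conj.
- move=> k neq_kj; have ck : coord (wi j) (ev m k) = 0.
    by rewrite coord_ev /= eq_sym (negbTE neq_kj).
  by rewrite (Emat_id (nm := nm)) // (fm_eq frm).
- by rewrite -/(tropical S j true) (fm_var frm) (mutvarE qS j true).
Qed.

(** Inverses of variables are monomials; conversely a monomial is, up to a power of [v], a product
    of variables and their inverses. *)
Lemma Lring_torus (S : seed F m n) x : (forall a b, formA (sL S) b a = - formA (sL S) a b) ->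
  is_frame v (formA (sL S)) (sX S) -> Lring v S x <-> torus v (sX S) x.
Proof.
move=> skewL frX; split.
  elim=> {x} [x [->|[->|[k [->|->]]]]|||x y _ Tx _ Ty|x _ Tx|x y _ Tx _ Ty].
  - by have := @span_vX F v _ (sX S) (fun _ => True) 1 0 I; rewrite expr1z (proj1 frX) mulr1.
  - by have := @span_vX F v _ (sX S) (fun _ => True) (-1) 0 I; rewrite exprN1 (proj1 frX) mulr1.
  - exact: span_X.
  - by rewrite (frameV v_unit skewL frX); apply: span_X.
  - exact: span_0.
  - by rewrite -(proj1 frX); apply: span_X.
  - exact: span_D.
  - exact: span_N.
  - exact: (torus_M v_unit v_central frX).
have Lv a : Lring v S (v ^ a).
  have Ln (y : F) (k : nat) : Lring v S y -> Lring v S (y ^+ k).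
    by move=> Ly; elim: k => [|k IHk]; [apply: gen_1|rewrite exprS; apply: gen_mul].
  case: a => k; first by apply: Ln; apply: gen_in; left.
  by rewrite NegzE -exprz_inv; apply: Ln; apply: gen_in; right; left.
elim=> [|a c _|y z _ Ly _ Lz|y _ Ly]; [exact: gen_0| |exact: gen_add|exact: gen_opp].
apply: gen_mul; first exact: Lv.
suff [] : Lring v S (sX S c) /\ Lring v S (sX S (- c)) by [].
apply: (@vector_subgroup_ind (fun c => Lring v S (sX S c) /\ Lring v S (sX S (- c))))
    => [|a1 b1 [A1 A2] [B1 B2]|b [B1 B2]|k _].
- by rewrite oppr0 (proj1 frX); split; apply: gen_1.
- by rewrite opprD !(frameD v_unit frX); split; (apply: gen_mul; [exact: Lv|exact: gen_mul]).
- by rewrite opprK.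
- rewrite -(frameV v_unit skewL frX).
  by split; apply: gen_in; right; right; exists k; [left|right].
Qed.

Lemma qseed_Lring (S : seed F m n) x : is_qseed S -> Lring v S x <-> torus v (sX S) x.
Proof. by move=> qS; apply: Lring_torus (qseed_skew qS) (qseed_frame qS). Qed.

Lemma torus_reindex (X Y : 'cV[int]_m -> F) (E : 'cV[int]_m -> 'cV[int]_m) x :
  (forall c, X c = Y (E c)) -> torus v X x -> torus v Y x.
Proof.
move=> XY; elim=> [|a c _|y z _ Ty _ Tz|y _ Ty].
- exact: span_0.
- by rewrite XY; apply: span_vX.
- exact: span_D.
- exact: span_N.
Qed.

(** * Two successive mutations in different directions *)

Section TwoMutations.
Variables (S S1 S2 S12 : seed F m n) (i j : 'I_n).
Hypotheses (qS : is_qseed S) (neq_ij : i != j).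
Hypotheses (mu1 : mutation i S S1) (mu2 : mutation j S S2) (mu12 : mutation j S1 S12).
Variable eps : bool.
Hypothesis sign_ij : sgn eps * sB S (wi i) j <= 0.

Let E (c : 'cV[int]_m) := Emat S i eps *m c.
Let EK c : E (E c) = c. Proof. exact: (EmatK nm). Qed.

Lemma sign_ji : 0 <= sgn eps * sB S (wi j) i.
Proof.
case: (qS) => skewL [D [D_gt0 LB]] _ _ _.
have := exchange_skew nm skewL LB i j; have := D_gt0 i; have := D_gt0 j.
by move: sign_ij; rewrite /sgn; case: (eps); nia.
Qed.

Lemma coord_E c : coord (wi j) (E c) = coord (wi j) c.
Proof.
rewrite /coord EmatE.
have -> : (wi j == wi i) = false by apply/negbTE; rewrite eq_sym.
by rewrite (max_idPr _) ?mul0r ?addr0 // oppr_le0 sign_ji.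
Qed.

(** For the sign fixed by [sign_ij], column [j] of [S1] is the image under [E] of that of [S];
    cancel [d j] and apply the involution [E]. *)
Lemma E_signed_beta : E (signed_beta S1 j eps) = signed_beta S j eps.
Proof.
have qS1 := mutation_qseed qS mu1.
have := mutation_col qS mu1 (eps := eps) (j := j); rewrite eq_sym => /(_ neq_ij sign_ij).
rewrite (beta_col qS1) (beta_col qS) -scalemxAr /signed_beta => /scalemx_inj -> //.
  by rewrite /E -scalemxAr -/(E _) EK.
by have := d_pos j; lia.
Qed.

(** Seen in the coordinates of [S], the second mutation has the same data as the mutation of [S]
    itself in direction [j], as [rank_two] demands. *)
Lemma twisted_second_mutation :
  frame_mut v (formA (sL S)) (coordA (wi j)) (tropical S j eps) (signed_beta S j eps)
    (d j) (h j) (twisted S S1 i eps) (fun c => twisted S1 S12 j eps (E c)).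
Proof.
have qS1 := mutation_qseed qS mu1.
have [EL _ _ _ _] := mutation_any_sign qS mu1 eps.
have frZ := twisted_frame qS mu1 eps.
have frm : frame_mut v (formA (sL S)) (coordA (wi j)) (E (tropical S1 j eps))
    (signed_beta S j eps) (d j) (h j) (twisted S S1 i eps)
    (fun c => twisted S1 S12 j eps (E c)).
  have [fr12 u12 b12 l12 e12 v12] := twisted_frame_mut qS1 mu12 eps.
  split.
  - split=> [|a b]; first by rewrite /E mulmx0 (proj1 fr12).
    rewrite (proj2 fr12) /E mulmxDr; congr (v ^ _ * _).
    by rewrite /= EL form_conj -!/(E _) !EK.
  - by rewrite /= coord_E.
  - by rewrite /= coord_signed_beta (coord_beta qS) mulr0.
  - by move=> c cj; rewrite /= formZr (form_beta_0 qS) // mulr0.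
  - by move=> c cj; rewrite e12 //= coord_E.
  - rewrite EK v12; apply: eq_bigr => r _; rewrite /twisted -/(E _).
    congr (_ * sX S1 _); rewrite -E_signed_beta.
    rewrite -(raddfMn (mulmx (Emat S i eps))) /E -mulmxDr -/(E _) EK //.
(* The two tropical vectors need not agree, but both have [j]-th coordinate [-1], so [fm_shift]
   passes from one to the other. *)
have -> : tropical S j eps = E (tropical S1 j eps) + (tropical S j eps - E (tropical S1 j eps)).
  by rewrite addrC subrK.
apply: (fm_shift v_unit v_central (h_coef j) frZ frm).
by rewrite formB [LHS]/= coord_E !tropical_entry !eqxx.
Qed.

Lemma rank_two_Lring x : Lring v S x -> Lring v S1 x -> Lring v S2 x -> Lring v S12 x.
Proof.
have qS1 := mutation_qseed qS mu1; have qS2 := mutation_qseed qS mu2.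
have qS12 := mutation_qseed qS1 mu12.
rewrite !qseed_Lring // => Lx L1x L2x.
have {}L1x : torus v (twisted S S1 i eps) x.
  by apply: (torus_reindex (E := E)) L1x => c; rewrite /twisted /E (EmatK nm).
have {}L2x : torus v (twisted S S2 j eps) x.
  apply: (torus_reindex (E := mulmx (Emat S j eps))) L2x => c.
  by rewrite /twisted (EmatK nm).
have neq_ji : (wi j == wi i) = false by apply/negbTE; rewrite eq_sym.
have dpos := d_pos.
suff : torus v (fun c => twisted S1 S12 j eps (E c)) x.
  exact: (torus_reindex (E := fun c => Emat S1 j eps *m E c)).
apply: (rank_two v_unit v_central (qseed_skew qS) (h_coef i) (h_coef j) (h_0 i)
  (qseed_frame qS) (qseed_indep qS) (twisted_frame_mut qS mu1 eps)
  (twisted_frame_mut qS mu2 eps) twisted_second_mutation (phi := grading S i eps)) => //=.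
- rewrite tropical_entry neq_ji; apply/max_idPr; have := sign_ji; lia.
- by rewrite tropical_entry eq_sym neq_ji le_max lexx orbT.
- rewrite coord_signed_beta; have := sign_ji; rewrite (beta_entry qS) mulrCA -/(coord _ _).
  have := dpos i; nia.
- rewrite coord_signed_beta; have := sign_ij; rewrite (beta_entry qS) mulrCA -/(coord _ _).
  have := dpos j; nia.
- rewrite !coord_signed_beta; have [[q1 q2] /= [q1_gt0 q2_gt0] Q] := coord_beta_sign qS i j.
  move: Q; rewrite /sgn; case: (eps); nia.
- exact: grading_gt0.
- exact: grading_eq0.
Qed.

End TwoMutations.

(** * Upper bounds under mutation *)

Lemma Ubound_mutation S S1 i x : is_qseed S -> mutation i S S1 ->
  Ubound v nm d h S x -> Ubound v nm d h S1 x.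
Proof.
move=> qS mu1 [Lx LSx]; split=> [|j S12 mu12]; first exact: LSx mu1.
have [eq_ij|neq_ij] := eqVneq i j; last first.
  have [S2 mu2] := mutation_exists j qS.
  have [eps sign] : exists eps, sgn eps * sB S (wi i) j <= 0.
    by case: (lerP (sB S (wi i) j) 0) => ?; [exists true|exists false]; rewrite /sgn; lia.
  exact: (rank_two_Lring qS neq_ij mu1 mu2 mu12 sign Lx (LSx _ _ mu1) (LSx _ _ mu2)).
(* For [j = i] the second mutation returns to the variables of [S]. *)
rewrite -{j}eq_ij in mu12.
have [_ _ _ Xk Xi] := mutation_any_sign (mutation_qseed qS mu1) mu12 true.
case: (mutation_sym qS mu1) => _ [_ _ _ Yk Yi].
have eqX (k : 'I_m) : sX S12 (ev m k) = sX S (ev m k).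
  have [E|neq_ki] := eqVneq (k : nat) i; last by rewrite Xk // Yk.
  by rewrite E Xi Yi.
elim: Lx => {x LSx} [x [->|[->|[k xE]]]|||x y _ Tx _ Ty|x _ Tx|x y _ Tx _ Ty].
- by apply: gen_in; left.
- by apply: gen_in; right; left.
- by apply: gen_in; right; right; exists k; rewrite eqX.
- exact: gen_0.
- exact: gen_1.
- exact: gen_add.
- exact: gen_opp.
- exact: gen_mul.
Qed.

Lemma Ubound_mutation_iff S S1 i x : is_qseed S -> mutation i S S1 ->
  Ubound v nm d h S x <-> Ubound v nm d h S1 x.
Proof.
move=> qS mu; split; first exact: (Ubound_mutation qS mu).
exact: (Ubound_mutation (mutation_qseed qS mu) (mutation_sym qS mu)).
Qed.

Lemma Ubound_mut_equiv S0 S : is_qseed S0 -> mut_equiv v nm d h S0 S ->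
  is_qseed S /\ forall x, Ubound v nm d h S0 x <-> Ubound v nm d h S x.
Proof.
move=> qS0; elim=> [|S1 S2 i _ [qS1 IH] mu]; first by [].
split=> [|x]; first exact: (mutation_qseed qS1 mu).
by rewrite IH; exact: (Ubound_mutation_iff x qS1 mu).
Qed.

End SeedMutation.

Theorem theorem4p8
  (F : unitRingType)
  (Fdiv : forall x : F, x != 0 -> x \is a GRing.unit)
  (v : F) (v_unit : v \is a GRing.unit) (v_central : forall x : F, v * x = x * v)
  (m n : nat) (n_pos : (0 < n)%N) (nm : (n <= m)%N)
  (d : 'I_n -> nat) (d_pos : forall k, (0 < d k)%N)
  (h : 'I_n -> nat -> F)
  (h_coef : forall k r, Zq v (h k r))
  (h_sym : forall k r, (r <= d k)%N -> h k r = h k (d k - r)%N)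
  (h_0 : forall k, h k 0%N = 1) (h_d : forall k, h k (d k) = 1)
  (S0 : seed F m n) (HS0 : is_qseed v d S0)
  (Hcop : coprime_seed v d h S0) :
  (forall (i : 'I_n) (S1 : seed F m n), mutation v nm d h i S0 S1 ->
     forall x, Ubound v nm d h S0 x <-> Ubound v nm d h S1 x) /\
  ((forall S, mut_equiv v nm d h S0 S -> coprime_seed v d h S) ->
     forall S, mut_equiv v nm d h S0 S ->
       forall x, Ubound v nm d h S x <-> Utilde v nm d h S0 x).
Proof.
split=> [i S1 mu x|_ S eqS x].
  exact: (Ubound_mutation_iff Fdiv v_unit v_central d_pos h_coef h_sym h_0 x HS0 mu).
have equiv S' := @Ubound_mut_equiv _ _ Fdiv v_unit v_central _ _ nm _ _ d_pos h_coef
  h_sym h_0 S0 S' HS0.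
(* The upper bound is the same for all equivalent seeds and lies in the torus of each. *)
split=> [Ux S' eqS'|Ux].
  case: (equiv S' eqS') => _ E'; case: (equiv S eqS) => _ E.
  by have [] := iffLR (E' x) (iffRL (E x) Ux).
(* Conversely, the upper bound involves only [S] and its neighbours, all mutation-equivalent to
   [S0]. *)
split=> [|i S' mu]; first exact: Ux.
exact: Ux (me_step eqS mu).
Qed.
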